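(* Let $S_+(\mathbb R^d)$ be the set of symmetric positive definite real $d\times d$ matrices and let $\Phi:\mathbb R^{2d}\times S_+(\mathbb R^d)^2\to\mathbb R$ be given by $$\Phi(\mu,\nu,A,B)=\|\mu-\nu\|^2+\mathrm{tr}(A)+\mathrm{tr}(B)-2\,\mathrm{tr}\big((A^{1/2}BA^{1/2})^{1/2}\big).$$ Then $\Phi$ is twice Fréchet differentiable. Its second derivative $D^2_{(\mu,\nu,A,B)}\Phi$ at a point $(\mu,\nu,A,B)\in\mathbb R^{2d}\times S_+(\mathbb R^d)^2$ is a symmetric bilinear map $\big(\mathbb R^{2d}\times\mathbb R^{2(d\times d)}\big)\times\big(\mathbb R^{2d}\times\mathbb R^{2(d\times d)}\big)\to\mathbb R$, which is determined by its quadratic form $D^2_{(\mu,\nu,A,B)}\Phi[(g,g',G,G'),(g,g',G,G')]$, $g,g'\in\mathbb R^d$, $G,G'\in\mathbb R^{d\times d}$.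
   Context: Square roots of symmetric positive definite matrices are the spectral ones. $S_+(\mathbb R^d)$ is viewed as a subset of $L(\mathbb R^d,\mathbb R^d)\simeq\mathbb R^{d\times d}$, and the square root is extended to matrices $A'$ in a neighbourhood of a given $A\in S_+(\mathbb R^d)$ by the holomorphic functional calculus $A'^{1/2}=\frac1{2\pi i}\int_\Gamma z^{1/2}(zI-A')^{-1}dz$ with $z^{1/2}$ the principal branch on $\mathbb C\setminus(-\infty,0]$ and $\Gamma$ the smooth boundary of a bounded open set $\Omega$ containing the spectrum, with $\overline\Omega\subset\mathbb C\setminus(-\infty,0]$; $\Phi$ is extended correspondingly. *)

(* Defs.v *)
From HB Require Import structures.
From mathcomp Require Import all_boot all_order all_algebra.
From mathcomp Require Import all_classical all_reals all_analysis.
From mathcomp Require Import complex.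

Set Implicit Arguments.
Unset Strict Implicit.
Unset Printing Implicit Defensive.
Import Order.TTheory GRing.Theory Num.Theory.
Import numFieldNormedType.Exports.

Local Open Scope classical_set_scope.
Local Open Scope ring_scope.
Local Open Scope complex_scope.

Section SecondDerivative.
Context {R : realType} {V : normedModType R}.
Implicit Types (f : V -> R) (p : V) (B : V -> V -> R).

Definition biscalar B : Prop := bilinear_for *%R *%R B.

(* B is the Frechet derivative at p of q |-> 'd f q, valued in the space of
   continuous linear forms with the operator norm: the last clause says
   || 'd f (p + h) - 'd f p - B h || <= e ||h|| for all small h.  The boundedness
   clause is the continuity of h |-> B h from V to that space. *)
Definition is_second_derivative f p B : Prop :=
  [/\ biscalar B,
      exists C : R, forall h k : V, `|B h k| <= C * `|h| * `|k| &
      forall e : R, 0 < e -> \forall h \near (0 : V), forall k : V,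
        `|'d f (p + h) k - 'd f p k - B h k| <= e * `|h| * `|k|].

Definition twice_differentiable f p : Prop :=
  (\forall q \near p, differentiable f q) /\
  exists B, is_second_derivative f p B.

Definition D2 f p : V -> V -> R := get (is_second_derivative f p).

End SecondDerivative.

Section SpectralSquareRoot.
Context {R : realType} {d : nat}.
Implicit Types A S : 'M[R]_d.

Definition spd A : Prop :=
  A^T = A /\ forall x : 'rV[R]_d, x != 0 -> 0 < (x *m A *m x^T) 0 0.

Definition is_spectral_sqrt A S : Prop :=
  exists (P : 'M[R]_d) (l : 'rV[R]_d),
    [/\ P *m P^T = 1%:M, forall i, 0 <= l 0 i,
        A = P^T *m diag_mx l *m P &
        S = P^T *m diag_mx (map_mx Num.sqrt l) *m P].

Definition spectral_sqrt A : 'M[R]_d := get (is_spectral_sqrt A).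

Definition complex_mx A : 'M[R[i]]_d := map_mx (real_complex R) A.

Definition spectrum A : set R[i] := [set z | eigenvalue (complex_mx A) z].

End SpectralSquareRoot.

Section FunctionalCalculus.
Context {R : realType}.
Implicit Types (c : R -> R[i]) (Omega K : set R[i]^o).

(* A curve is parametrized by the whole line with period 1; its trace is
   the image of `[0, 1]. *)
Definition velocity c (t : R) : R[i] :=
  derive1 (fun s => complex.Re (c s)) t +i* derive1 (fun s => complex.Im (c s)) t.

Definition smooth_jordan_curve c : Prop :=
  [/\ forall t, c (t + 1) = c t,
      forall s t : R, 0 <= s < 1 -> 0 <= t < 1 -> c s = c t -> s = t,
      forall (n : nat) (t : R), derivable (derive1n n (fun s => complex.Re (c s))) t 1 /\
                  derivable (derive1n n (fun s => complex.Im (c s))) t 1 &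
      forall t, velocity c t != 0].

Record contour := Contour {
  ncurves : nat ;
  curve : 'I_ncurves -> R -> R[i] }.

Implicit Types G : contour.

Definition contour_trace G : set R[i]^o := [set z | exists k t, z = @curve G k t].

Definition curve_integral c (f : R[i] -> R[i]) : R[i] :=
  let F t := f (c t) * velocity c t in
  (\int[lebesgue_measure]_(t in `[0, 1]) complex.Re (F t)) +i*
  (\int[lebesgue_measure]_(t in `[0, 1]) complex.Im (F t)).

Definition contour_integral G (f : R[i] -> R[i]) : R[i] :=
  \sum_(k < ncurves G) curve_integral (curve k) f.

Definition two_pi_i : R[i] := (2 * pi)%:C * 'i.

Definition winding_number G (a : R[i]) : R[i] :=
  two_pi_i^-1 * contour_integral G (fun z => (z - a)^-1).

(* The positive orientation of the boundary is expressed by winding numbers. *)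
Definition smooth_oriented_boundary G Omega : Prop :=
  [/\ forall k, smooth_jordan_curve (@curve G k),
      forall j k s t, @curve G j s = @curve G k t -> j = k,
      contour_trace G = closure Omega `\` Omega,
      forall a, Omega a -> winding_number G a = 1 &
      forall a, ~ closure Omega a -> winding_number G a = 0].

(* In the partial order of R[i], z <= 0 means that z is in ]-oo, 0]. *)
Definition sqrt_contour K Omega G : Prop :=
  [/\ open Omega, bounded_set Omega, smooth_oriented_boundary G Omega,
      K `<=` Omega & closure Omega `<=` [set z : R[i] | ~~ (z <= 0)]].

(* sqrtc is the principal branch off ]-oo, 0]. *)
Definition holomorphic_sqrt G d (M : 'M[R[i]]_d) : 'M[R[i]]_d :=
  \matrix_(i, j) (two_pi_i^-1 *
    contour_integral G (fun z => sqrtc z * invmx (z%:M - M) i j)).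

End FunctionalCalculus.

Arguments contour R : clear implicits.

(* The points (mu, nu, (A, B)). *)
Notation gaussian_pair R d :=
  ('rV[R]_d * 'rV[R]_d * ('M[R]_d * 'M[R]_d))%type.

Section Phi.
Context {R : realType} {d : nat}.
Implicit Type q : gaussian_pair R d.

(* Matrices carry the sup norm in the library, hence the explicit sum. *)
Definition sqr_dist (mu nu : 'rV[R]_d) : R := \sum_i (mu 0 i - nu 0 i) ^+ 2.

Definition Phi q : R :=
  let: (mu, nu, (A, B)) := q in
  sqr_dist mu nu + \tr A + \tr B -
  2 * \tr (spectral_sqrt (spectral_sqrt A *m B *m spectral_sqrt A)).

(* Extension of Phi to arbitrary matrices, G1 and G2 being the contours used
   for the inner and the outer square roots. *)
Definition Phi_ext (G1 G2 : contour R) q : R[i] :=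
  let: (mu, nu, (A, B)) := q in
  let S := holomorphic_sqrt G1 (complex_mx A) in
  (sqr_dist mu nu + \tr A + \tr B)%:C -
  2 * \tr (holomorphic_sqrt G2 (S *m complex_mx B *m S)).

End Phi.

(* Main.v *)
Require Import Defs.
From HB Require Import structures.
From mathcomp Require Import all_boot all_order all_algebra.
From mathcomp Require Import all_classical all_reals all_analysis.
From mathcomp Require Import complex.
From mathcomp Require Import ring lra.
Set Implicit Arguments.
Unset Strict Implicit.
Unset Printing Implicit Defensive.
Import Order.TTheory GRing.Theory Num.Theory.
Import numFieldNormedType.Exports.
Local Open Scope classical_set_scope.
Local Open Scope ring_scope.
Local Open Scope complex_scope.

(* The contour integrals are evaluated through primitives along closed curves only.
   If [T T = M] and the eigenvalues of [T] have positive real parts, then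
   [sqrt z / (z - M) = T / (z - M) + 1 / (sqrt z + T)] on the contour: the first
   term integrates to [2 pi i T] by the winding number condition, and the second,
   rewritten with [w = sqrt z], to [0], because [w + t] stays in a half-plane where
   the logarithm is a primitive.  So the holomorphic square root of a matrix near
   [A] is its square root near [A^{1/2}], which exists by Banach's theorem and is
   unique since [X |-> V X + X W] is invertible for [V], [W] near [A^{1/2}].

   Conjugating by [A^{1/2}], [tr (A^{1/2} B A^{1/2})^{1/2} = tr U] where [U] is the
   square root of [A B] near a matrix similar to a positive diagonal one.  From
   [U U = A B] one gets [d (2 tr U) = tr (U^-1 d(A B))], and once more
   [d (U^-1) = - U^-1 dU U^-1] with [U dU + dU U = d(A B)]; the remainders
   are explicit and quadratic.  The second derivative is symmetric by
   cyclicity of the trace. *)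

(** * Paths in the complex plane *)

(** All that is known of a contour is its winding numbers, that is the integrals of [1 / (z - a)].
    The resolvent of a matrix that need not be diagonalizable is brought down to these by Newton
    interpolation at the roots of its characteristic polynomial.

    Off the symmetric matrices, [A^{1/2} B A^{1/2}] has no spectral theorem, even close to a
    positive definite matrix. So the local analysis diagonalizes at the base point alone; around it
    everything rests on estimates whose constants come from that point: a lower bound for
    [X |-> V X + X W], a bound for inverses, and Bauer-Fike for eigenvalues.

    Passing to [U U = A B] removes [A^{1/2}] from the differentiation, and the increments of the
    bilinear [A B] are exact. The trace helps further: an increment [X] of [U] satisfies
    [U X + X U + X X = d(A B)], and multiplying by [U^-1] and taking traces gives [2 tr X] up to a
    quadratic term. Hence the first derivative, wanted at all nearby points, only uses [X = O(|h|)];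
    the second one solves the Sylvester equation, but at the base point only. *)

Section ComplexValuedPaths.
Context {R : realType}.
Implicit Types (x y z : R[i]) (phi psi : R -> R[i]) (c : R -> R[i]).

Lemma ReD x y : complex.Re (x + y) = complex.Re x + complex.Re y.
Proof. by case: x y => [? ?] []. Qed.
Lemma ImD x y : complex.Im (x + y) = complex.Im x + complex.Im y.
Proof. by case: x y => [? ?] []. Qed.
Lemma ReN x : complex.Re (- x) = - complex.Re x.
Proof. by case: x. Qed.
Lemma ImN x : complex.Im (- x) = - complex.Im x.
Proof. by case: x. Qed.
Lemma ReM x y : complex.Re (x * y) =
  complex.Re x * complex.Re y - complex.Im x * complex.Im y.
Proof. by case: x y => [? ?] []. Qed.
Lemma ImM x y : complex.Im (x * y) =
  complex.Re x * complex.Im y + complex.Im x * complex.Re y.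
Proof. by case: x y => [? ?] []. Qed.
Lemma ReV x : complex.Re x^-1 =
  complex.Re x / (complex.Re x ^+ 2 + complex.Im x ^+ 2).
Proof. by case: x. Qed.
Lemma ImV x : complex.Im x^-1 =
  - complex.Im x / (complex.Re x ^+ 2 + complex.Im x ^+ 2).
Proof. by case: x => a b; rewrite mulNr. Qed.
Definition ReImE := (ReD, ImD, ReN, ImN, ReM, ImM, ReV, ImV).

Lemma complex_eqP x y :
  complex.Re x = complex.Re y -> complex.Im x = complex.Im y -> x = y.
Proof. by case: x y => a b [a' b'] /= -> ->. Qed.

Lemma sqr_norm_neq0 x : x != 0 ->
  complex.Re x ^+ 2 + complex.Im x ^+ 2 != 0.
Proof.
case: x => a b; apply: contra; rewrite /= paddr_eq0 ?sqr_ge0// !sqrf_eq0.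
by move=> /andP[/eqP -> /eqP ->].
Qed.

Lemma is_derive_mulf (f g : R -> R) f' g' (t : R) :
  is_derive t 1 f f' -> is_derive t 1 g g' ->
  is_derive t 1 (fun s => f s * g s) (f' * g t + f t * g').
Proof.
move=> a b; have ab := is_deriveM a b; apply: (is_derive_eq ab).
by rewrite /GRing.scale/=; ring.
Qed.

Lemma is_derive_addf (f g : R -> R) f' g' (t : R) :
  is_derive t 1 f f' -> is_derive t 1 g g' ->
  is_derive t 1 (fun s => f s + g s) (f' + g').
Proof. by move=> a b; have ab := is_deriveD a b; apply: (is_derive_eq ab). Qed.

Lemma is_derive_oppf (f : R -> R) f' (t : R) :
  is_derive t 1 f f' -> is_derive t 1 (fun s => - f s) (- f').
Proof. by move=> a; have ab := is_deriveN a; apply: (is_derive_eq ab). Qed.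

Lemma is_derive_invf (f : R -> R) f' (t : R) : f t != 0 ->
  is_derive t 1 f f' -> is_derive t 1 (fun s => (f s)^-1) (- f' / f t ^+ 2).
Proof.
move=> n0 a; have ab := is_deriveV n0 a; apply: (is_derive_eq ab).
by rewrite /GRing.scale/= -exprVn; ring.
Qed.

Lemma is_derive_sqrf (f : R -> R) f' (t : R) :
  is_derive t 1 f f' -> is_derive t 1 (fun s => f s ^+ 2) (2 * f t * f').
Proof.
by move=> a; apply: (is_derive_eq (is_derive_mulf a a)); ring.
Qed.

(** [velocity] and [curve_integral] are defined through real and imaginary parts, so continuity and
    derivatives of paths are componentwise too, and reduce to real calculus in one variable. *)
Definition path_continuous phi :=
  continuous (fun t => complex.Re (phi t)) /\
  continuous (fun t => complex.Im (phi t)).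

Definition path_derivative phi psi := forall t : R,
  is_derive t 1 (fun s => complex.Re (phi s)) (complex.Re (psi t)) /\
  is_derive t 1 (fun s => complex.Im (phi s)) (complex.Im (psi t)).

Lemma eq_path_continuous phi psi :
  phi =1 psi -> path_continuous phi -> path_continuous psi.
Proof. by move=> /funext ->. Qed.

Lemma path_continuous_cst x : path_continuous (fun=> x).
Proof. by split => t; apply: cvg_cst. Qed.

Lemma path_continuousD phi psi : path_continuous phi -> path_continuous psi ->
  path_continuous (fun t => phi t + psi t).
Proof.
move=> [a b] [c d]; split => t; under eq_fun do rewrite ReImE.
  exact: cvgD (a t) (c t).
exact: cvgD (b t) (d t).
Qed.

Lemma path_continuousN phi : path_continuous phi ->
  path_continuous (fun t => - phi t).
Proof.
move=> [a b]; split => t; under eq_fun do rewrite ReImE.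
  exact: cvgN (a t).
exact: cvgN (b t).
Qed.

Lemma path_continuousM phi psi : path_continuous phi -> path_continuous psi ->
  path_continuous (fun t => phi t * psi t).
Proof.
move=> [a b] [c d]; split => t; under eq_fun do rewrite ReImE.
  exact: cvgB (cvgM (a t) (c t)) (cvgM (b t) (d t)).
exact: cvgD (cvgM (a t) (d t)) (cvgM (b t) (c t)).
Qed.

Lemma path_continuousV phi : path_continuous phi -> (forall t, phi t != 0) ->
  path_continuous (fun t => (phi t)^-1).
Proof.
move=> [a b] n0; split => t; under eq_fun do rewrite ReImE.
  apply: cvgM; first exact: a.
  apply: cvgV; first exact: sqr_norm_neq0.
  by apply: cvgD; apply: (@cvgM _ _ (nbhs t)); first [exact: a | exact: b].
apply: cvgM; first exact: cvgN (b t).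
apply: cvgV; first exact: sqr_norm_neq0.
by apply: cvgD; apply: (@cvgM _ _ (nbhs t)); first [exact: a | exact: b].
Qed.

Lemma path_continuous_sum I (r : seq I) (F : I -> R -> R[i]) :
  (forall i, path_continuous (F i)) ->
  path_continuous (fun t => \sum_(i <- r) F i t).
Proof.
move=> FP; elim: r => [|i r IH].
  by apply: eq_path_continuous (path_continuous_cst 0) => t; rewrite big_nil.
by apply: eq_path_continuous (path_continuousD (FP i) IH) => t; rewrite big_cons.
Qed.

Lemma path_continuousX phi n : path_continuous phi ->
  path_continuous (fun t => phi t ^+ n).
Proof.
move=> H; elim: n => [|n IH].
  exact: eq_path_continuous (path_continuous_cst 1).
under eq_fun do rewrite exprS.
exact: path_continuousM.
Qed.

Lemma path_derivative_continuous phi psi :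
  path_derivative phi psi -> path_continuous phi.
Proof.
move=> H; split => t; have [[a _] [b _]] := H t.
  by apply: differentiable_continuous; apply/derivable1_diffP.
by apply: differentiable_continuous; apply/derivable1_diffP.
Qed.

Lemma eq_path_derivative phi psi psi' :
  psi =1 psi' -> path_derivative phi psi -> path_derivative phi psi'.
Proof. by move=> /funext ->. Qed.

Lemma path_derivative_cst x : path_derivative (fun=> x) (fun=> 0).
Proof. by move=> t; split; exact: is_derive_cst. Qed.

Lemma path_derivativeD phi psi phi' psi' :
  path_derivative phi phi' -> path_derivative psi psi' ->
  path_derivative (fun t => phi t + psi t) (fun t => phi' t + psi' t).
Proof.
move=> H K t; have [a b] := H t; have [c d] := K t.
split; under eq_fun do rewrite ReImE; rewrite ReImE.
  exact: is_deriveD.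
exact: is_deriveD.
Qed.

Lemma path_derivativeN phi phi' :
  path_derivative phi phi' ->
  path_derivative (fun t => - phi t) (fun t => - phi' t).
Proof.
move=> H t; have [a b] := H t.
by split; under eq_fun do rewrite ReImE; rewrite ReImE; exact: is_deriveN.
Qed.

Lemma path_derivativeM phi psi phi' psi' :
  path_derivative phi phi' -> path_derivative psi psi' ->
  path_derivative (fun t => phi t * psi t)
    (fun t => phi' t * psi t + phi t * psi' t).
Proof.
move=> H K t; have [a b] := H t; have [c d] := K t.
split; under eq_fun do rewrite ReImE; rewrite !ReImE.
  apply: (is_derive_eq (is_derive_addf (is_derive_mulf a c) (is_derive_oppf (is_derive_mulf b d)))).
  by ring.
apply: (is_derive_eq (is_derive_addf (is_derive_mulf a d) (is_derive_mulf b c))).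
by ring.
Qed.

Lemma path_derivativeV phi phi' :
  path_derivative phi phi' -> (forall t, phi t != 0) ->
  path_derivative (fun t => (phi t)^-1) (fun t => - phi' t / phi t ^+ 2).
Proof.
move=> H n0 t; have [a b] := H t; have n2 := sqr_norm_neq0 (n0 t).
have dV := @is_derive_invf
  (fun s => complex.Re (phi s) ^+ 2 + complex.Im (phi s) ^+ 2) _ t n2
  (is_derive_addf (is_derive_sqrf a) (is_derive_sqrf b)).
(* Dividing by [phi t ^+ 2] brings in its squared modulus, the square of that of [phi t]. *)
have n4 (x y : R) : x ^+ 2 + y ^+ 2 != 0 ->
    (x * x - y * y) ^+ 2 + (x * y + y * x) ^+ 2 != 0.
  move=> xy; rewrite [X in X != 0](_ : _ = (x ^+ 2 + y ^+ 2) ^+ 2); last by ring.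
  by rewrite expf_neq0.
have {}n4 := n4 _ _ n2.
split; under eq_fun do rewrite ReImE; rewrite !ReImE.
  apply: (is_derive_eq (is_derive_mulf a dV)).
  by field; apply/andP; split; first [exact: n4|exact: n2].
apply: (is_derive_eq (is_derive_mulf (is_derive_oppf b) dV)).
by field; apply/andP; split; first [exact: n4|exact: n2].
Qed.

Lemma path_derivativeX phi phi' n :
  path_derivative phi phi' ->
  path_derivative (fun t => phi t ^+ n.+1) (fun t => n.+1%:R * phi' t * phi t ^+ n).
Proof.
move=> H; elim: n => [|n IH].
  by apply: eq_path_derivative H => t; rewrite expr0 mulr1 mul1r.
under eq_fun do rewrite exprS.
apply: eq_path_derivative (path_derivativeM H IH) => t /=.
by rewrite -[in RHS]natr1 exprS; ring.
Qed.

Lemma velocityE c c' : path_derivative c c' -> velocity c = c'.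
Proof.
move=> H; apply/funext => t; have [[_ a] [_ b]] := H t.
by apply: complex_eqP; rewrite /= derive1E ?a ?b.
Qed.

Definition path_integral phi : R[i] :=
  (\int[lebesgue_measure]_(t in `[0, 1]) complex.Re (phi t)) +i*
  (\int[lebesgue_measure]_(t in `[0, 1]) complex.Im (phi t)).

Lemma continuous_integrable01 (f : R -> R) : continuous f ->
  lebesgue_measure.-integrable `[0, 1]%classic (EFin \o f).
Proof.
move=> cf; apply: continuous_compact_integrable; first exact: segment_compact.
exact: continuous_subspaceT.
Qed.

Lemma path_integralD phi psi : path_continuous phi -> path_continuous psi ->
  path_integral (fun t => phi t + psi t) = path_integral phi + path_integral psi.
Proof.
move=> [a b] [c d]; rewrite /path_integral.
under eq_Rintegral do rewrite ReImE.
rewrite RintegralD//; [|exact: continuous_integrable01..].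
by under [in X in _ +i* X = _]eq_Rintegral do rewrite ReImE;
  rewrite RintegralD//; exact: continuous_integrable01.
Qed.

Lemma path_integralZ x phi : path_continuous phi ->
  path_integral (fun t => x * phi t) = x * path_integral phi.
Proof.
move=> [a b]; have ia := continuous_integrable01 a.
have ib := continuous_integrable01 b.
have Zc r (f : R -> R) : continuous f -> continuous (fun t => r * f t).
  by move=> cf t; apply: cvgM; [exact: cvg_cst|exact: cf].
apply: complex_eqP; rewrite /path_integral ReImE /=.
  under eq_Rintegral do rewrite ReImE.
  by rewrite RintegralB ?RintegralZl//; apply: continuous_integrable01; exact: Zc.
under eq_Rintegral do rewrite ReImE.
by rewrite RintegralD ?RintegralZl//; apply: continuous_integrable01; exact: Zc.
Qed.

Lemma Rintegral01_derive (f F : R -> R) : continuous f ->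
  (forall t : R, is_derive t 1 F (f t)) ->
  \int[lebesgue_measure]_(t in `[0, 1]) f t = F 1 - F 0.
Proof.
move=> cf dF; rewrite /Rintegral.
have cF : continuous F.
  move=> t; have [a _] := dF t.
  by apply: differentiable_continuous; apply/derivable1_diffP.
rewrite (@continuous_FTC2 _ f F 0 1)//.
- exact: continuous_subspaceT.
- split; first by move=> t _; have [] := dF t.
    by apply: cvg_at_right_filter; exact: cF.
  by apply: cvg_at_left_filter; exact: cF.
- by move=> t _; rewrite derive1E; have [_ ->] := dF t.
Qed.

Lemma path_integral_derivative phi psi : path_derivative phi psi ->
  path_continuous psi -> path_integral psi = phi 1 - phi 0.
Proof.
move=> H [a b]; apply: complex_eqP; rewrite /path_integral !ReImE /=.
  by apply: (@Rintegral01_derive _ (fun t => complex.Re (phi t)) a) => t; have [] := H t.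
by apply: (@Rintegral01_derive _ (fun t => complex.Im (phi t)) b) => t; have [] := H t.
Qed.

Lemma eq_path_integral phi psi : phi =1 psi -> path_integral phi = path_integral psi.
Proof. by move=> /funext ->. Qed.

End ComplexValuedPaths.

(** * Contour integrals *)

Section ContourIntegrals.
Context {R : realType}.
Implicit Types (x y z w : R[i]) (c : R -> R[i]) (G : contour R) (f g : R[i] -> R[i]).

(** Closed [C^1] curves: what integrating primitives takes from the boundary. Asking for one
    derivative makes the property easy to carry over to the image of the contour under [sqrtc]. *)
Definition regular_contour G := forall k,
  [/\ @curve R G k 1 = @curve R G k 0,
      path_derivative (@curve R G k) (velocity (@curve R G k)) &
      path_continuous (velocity (@curve R G k))].

Definition continuous_along G f :=
  forall k, path_continuous (fun t => f (@curve R G k t)).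

Lemma smooth_jordan_regular G :
  (forall k, smooth_jordan_curve (@curve R G k)) -> regular_contour G.
Proof.
move=> H k; have [per _ sm _] := H k; split.
- by have := per 0; rewrite add0r.
- move=> t; have [a b] := sm 0%N t.
  by split; apply: DeriveDef; [exact: a|rewrite /= derive1E|exact: b|rewrite /= derive1E].
- have dc (g : R -> R) (t : R) : derivable g t 1 -> {for t, continuous g}.
    by move=> dg; apply: differentiable_continuous; apply/derivable1_diffP.
  by split => t; have [a b] := sm 1%N t; [exact: (dc _ _ a)|exact: (dc _ _ b)].
Qed.

Section Regular.
Variables (G : contour R) (regG : regular_contour G).

Lemma regular_continuous : continuous_along G id.
Proof. by move=> k; have [_ /path_derivative_continuous] := regG k. Qed.

Let integrand_continuous f k : continuous_along G f ->
  path_continuous (fun t => f (@curve R G k t) * velocity (@curve R G k) t).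
Proof. by move=> cf; have [_ _ cv] := regG k; apply: path_continuousM. Qed.

Lemma contour_integralD f g : continuous_along G f -> continuous_along G g ->
  contour_integral G (fun z => f z + g z) =
  contour_integral G f + contour_integral G g.
Proof.
move=> cf cg; rewrite /contour_integral -big_split; apply: eq_bigr => k _ /=.
rewrite -[RHS]path_integralD; [|exact: integrand_continuous..].
by apply: eq_path_integral => t; rewrite mulrDl.
Qed.

Lemma contour_integralZ x f : continuous_along G f ->
  contour_integral G (fun z => x * f z) = x * contour_integral G f.
Proof.
move=> cf; rewrite /contour_integral mulr_sumr; apply: eq_bigr => k _ /=.
rewrite -[RHS]path_integralZ; last exact: integrand_continuous.
by apply: eq_path_integral => t; rewrite mulrA.
Qed.

(** The primitive is differentiated along the curves only, so holomorphy of [P] never has to be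
    formulated; the ends of each curve coincide. *)
Lemma contour_integral_primitive (P : R[i] -> R[i]) f : continuous_along G f ->
  (forall k, path_derivative (fun t => P (@curve R G k t))
     (fun t => f (@curve R G k t) * velocity (@curve R G k) t)) ->
  contour_integral G f = 0.
Proof.
move=> cf dP; rewrite /contour_integral big1// => k _; have [c01 _ _] := regG k.
rewrite -[LHS]/(path_integral _).
rewrite (path_integral_derivative (dP k)); last exact: integrand_continuous.
by rewrite c01 subrr.
Qed.

Lemma eq_contour_integral f g : (forall k t, f (@curve R G k t) = g (@curve R G k t)) ->
  contour_integral G f = contour_integral G g.
Proof.
move=> fg; apply: eq_bigr => k _; rewrite -[LHS]/(path_integral _).
by apply: eq_path_integral => t; rewrite fg.
Qed.

Lemma contour_integral_sum I (r : seq I) (F : I -> R[i] -> R[i]) :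
  (forall i, continuous_along G (F i)) ->
  contour_integral G (fun z => \sum_(i <- r) F i z) =
  \sum_(i <- r) contour_integral G (F i).
Proof.
move=> cF; elim: r => [|i r IH].
  rewrite big_nil (@contour_integral_primitive (fun=> 0))// => k.
    by apply: eq_path_continuous (path_continuous_cst 0) => t; rewrite big_nil.
  apply: eq_path_derivative (path_derivative_cst 0) => t.
  by rewrite big_nil mul0r.
rewrite big_cons -IH -contour_integralD//; last first.
  by move=> k; apply: path_continuous_sum => j; exact: cF.
by apply: eq_contour_integral => k t; rewrite big_cons.
Qed.

Definition avoids x := forall k t, @curve R G k t != x.

Lemma avoids_inv_continuous x :
  avoids x -> continuous_along G (fun z => (z - x)^-1).
Proof.
move=> ax k; apply: path_continuousV; last by move=> t; rewrite subr_eq0.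
by apply: path_continuousD; [exact: regular_continuous|exact: path_continuous_cst].
Qed.

Lemma avoids_prod_continuous s : {in s, forall x, avoids x} ->
  continuous_along G (fun z => \prod_(x <- s) (z - x)^-1).
Proof.
move=> H k; elim: s H => [|x s IH] H.
  by apply: eq_path_continuous (path_continuous_cst 1) => t; rewrite big_nil.
have Hs : {in s, forall x, avoids x} by move=> y ys; apply: H; rewrite inE ys orbT.
have Hx : avoids x by apply: H; rewrite mem_head.
apply: eq_path_continuous (path_continuousM (avoids_inv_continuous Hx k) (IH Hs)).
by move=> t; rewrite big_cons.
Qed.

Lemma contour_integral_pole x n : avoids x ->
  contour_integral G (fun z => (z - x)^-1 ^+ n.+2) = 0.
Proof.
move=> ax; pose P z : R[i] := - n.+1%:R^-1 * (z - x)^-1 ^+ n.+1.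
apply: (@contour_integral_primitive P).
  by move=> k; apply: path_continuousX; exact: avoids_inv_continuous.
move=> k; have [_ dc _] := regG k.
have zx t : @curve R G k t - x != 0 by rewrite subr_eq0.
have d1 := path_derivativeD dc (path_derivative_cst (- x)).
have d2 := path_derivativeX n (path_derivativeV d1 zx).
apply: eq_path_derivative (path_derivativeM (path_derivative_cst (- n.+1%:R^-1)) d2).
move=> t /=; have : (n.+1%:R : R[i]) != 0 by rewrite pnatr_eq0.
rewrite -[in RHS](addn2 n) exprD expr2; move: (n.+1%:R : R[i]) => u u0.
by field; rewrite zx u0.
Qed.

(* Partial fractions reduce distinct poles to simple ones, whose contributions
   cancel; a single pole of higher order has a primitive. *)
Lemma contour_integral_poles w s : (0 < size s)%N ->
  {in s, forall x, avoids x /\ contour_integral G (fun z => (z - x)^-1) = w} ->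
  contour_integral G (fun z => \prod_(x <- s) (z - x)^-1) = w *+ (size s == 1%N).
Proof.
case: s => // x s _; elim: {s}(size s) {-2}s (erefl (size s)) x => [|n IH] s.
  move=> /eqP /nilP -> x /(_ x (mem_head _ _)) [ax <-].
  by rewrite mulr1n; apply: eq_contour_integral => k t; rewrite big_seq1.
move=> ss x H; rewrite /= ss mulr0n.
have [/all_pred1P sE|] := boolP (all (pred1 x) s).
  rewrite -[RHS](@contour_integral_pole x n); last by have [] := H x (mem_head _ _).
  apply: eq_contour_integral => k t; rewrite big_cons sE ss.
  by rewrite big_nseq iter_mulr_1 -exprS.
move=> /allPn [y ys /= yx]; set r := rem y s.
have sr : perm_eq s (y :: r) by exact: perm_to_rem.
have rn : size r = n by have := perm_size sr; rewrite ss /= => -[].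
have rs z : z \in r -> z \in s by move=> /mem_rem.
have Hx : {in x :: r, forall z, avoids z /\ contour_integral G (fun t => (t - z)^-1) = w}.
  move=> z; rewrite inE => /orP[/eqP ->|/rs zs]; apply: H.
    exact: mem_head.
  by rewrite inE zs orbT.
have Hy : {in y :: r, forall z, avoids z /\ contour_integral G (fun t => (t - z)^-1) = w}.
  move=> z; rewrite -(perm_mem sr) => zs; apply: H.
  by rewrite inE zs orbT.
have xy : x - y != 0 by rewrite subr_eq0 eq_sym.
(* Both products on the right have [n.+1] factors, so the induction hypothesis gives them the same
   integral, including [w] for [n = 0], and the difference cancels. *)
rewrite (@eq_contour_integral _ (fun z => (x - y)^-1 *
    (\prod_(u <- x :: r) (z - u)^-1 + (- 1) * \prod_(u <- y :: r) (z - u)^-1))).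
  have cx : continuous_along G (fun z => \prod_(u <- x :: r) (z - u)^-1).
    by apply: avoids_prod_continuous => z /Hx [].
  have cy : continuous_along G (fun z => \prod_(u <- y :: r) (z - u)^-1).
    by apply: avoids_prod_continuous => z /Hy [].
  have cy' : continuous_along G (fun z => -1 * \prod_(u <- y :: r) (z - u)^-1).
    by move=> k; apply: path_continuousM; [exact: path_continuous_cst|exact: cy].
  rewrite contour_integralZ; last by move=> k; exact: path_continuousD (cx k) (cy' k).
  rewrite contour_integralD// contour_integralZ// !IH//.
  by rewrite mulN1r subrr mulr0.
move=> k t; have [ax _] := Hx x (mem_head _ _); have [ay _] := Hy y (mem_head _ _).
have {}ax : @curve R G k t - x != 0 by rewrite subr_eq0.
have {}ay : @curve R G k t - y != 0 by rewrite subr_eq0.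
rewrite big_cons (perm_big _ sr) !big_cons /=.
by field; rewrite ax ay xy.
Qed.

End Regular.
End ContourIntegrals.

(** * Contour integrals of resolvents *)

Section ResolventIntegrals.
Context {R : realType}.
Implicit Types (x y z w : R[i]).

(** Newton interpolation of [t |-> 1 / (z - t)] at the nodes [l], evaluated at [M]: its divided
    differences are the products of the [(z - x)^-1]. When [l] lists the eigenvalues with
    multiplicity, the remainder vanishes by Cayley-Hamilton. *)
Lemma resolvent_newton n (M : 'M[R[i]]_n.+1) (l : seq R[i]) z :
  {in l, forall x, z != x} -> z%:M - M \in unitmx ->
  invmx (z%:M - M) =
  \sum_(k < size l) (\prod_(x <- take k.+1 l) (z - x)^-1) *:
     (\prod_(x <- take k l) (M - x%:M)) +
  (\prod_(x <- l) (z - x)^-1) *: ((\prod_(x <- l) (M - x%:M)) *m invmx (z%:M - M)).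
Proof.
move=> + zM; elim/last_ind: l => [|l x IH] zl.
  by rewrite big_ord0 !big_nil scale1r mul1mx add0r.
have zx : z - x != 0 by rewrite subr_eq0 zl// mem_rcons mem_head.
rewrite [LHS]IH; last by move=> y yl; apply: zl; rewrite mem_rcons inE yl orbT.
rewrite size_rcons big_ord_recr /= -addrA; congr (_ + _).
  apply: eq_bigr => k _; rewrite -cats1 !takel_cat//; exact: ltnW.
rewrite -cats1 [take (size l) _]take_size_cat// take_oversize ?size_cat ?addn1//.
rewrite !big_cat !big_seq1 /= -scalerDr -scalerA; congr (_ *: _).
have -> : (z - x)^-1 *: (\prod_(y <- l) (M - y%:M) +
    \prod_(y <- l) (M - y%:M) * (M - x%:M) *m invmx (z%:M - M)) =
    \prod_(y <- l) (M - y%:M) *m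
      ((z - x)^-1 *: (1%:M + (M - x%:M) *m invmx (z%:M - M))).
  move: (\prod_(y <- l) _) (invmx _) => N V.
  by rewrite -mulmxE -scalemxAr [in RHS]mulmxDr mulmx1 mulmxA.
congr (_ *m _); have -> : M - x%:M = (z - x)%:M - (z%:M - M).
  by rewrite (raddfB (@scalar_mx _ _)) /= opprB [RHS]addrC addrA subrK.
rewrite mulmxBl mulmxV// [1%:M + _]addrC subrK mul_scalar_mx scalerA mulVf// scale1r.
by [].
Qed.

Section Regular.
Variables (G : contour R) (regG : regular_contour G).

Lemma avoids_resolvent_unit d (M : 'M[R[i]]_d) k t :
  (forall x, eigenvalue M x -> avoids G x) -> (@curve R G k t)%:M - M \in unitmx.
Proof.
move=> eigM; rewrite unitmxE unitfE; apply/negP => /det0P [v v0 vM].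
have ev : eigenvalue M (@curve R G k t).
  by apply/eigenvalueP; exists v => //; apply/eqP; rewrite -subr_eq0 -mul_mx_scalar
    -mulmxBr -oppr_eq0 -mulmxN opprB vM.
by have /(_ k t) := eigM _ ev; rewrite eqxx.
Qed.

(** In the Newton expansion the term of index [m] has [m.+1] poles. So only the term of index 0
    contributes; it has one pole and the identity matrix as coefficient. Continuity is read off the
    same expansion. *)
Lemma contour_integral_resolvent w d (M : 'M[R[i]]_d) i j :
  (forall x, eigenvalue M x ->
     avoids G x /\ contour_integral G (fun z => (z - x)^-1) = w) ->
  continuous_along G (fun z => invmx (z%:M - M) i j) /\
  contour_integral G (fun z => invmx (z%:M - M) i j) = w *+ (i == j).
Proof.
case: d M i j => [|n] M i j eigM; first by case: i.
have unitM k t : (@curve R G k t)%:M - M \in unitmx.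
  by apply: avoids_resolvent_unit => x /eigM [].
have [l lE] := closed_field_poly_normal (char_poly M).
rewrite (monicP (char_poly_monic M)) scale1r in lE.
have lP x : x \in l -> eigenvalue M x.
  by rewrite eigenvalue_root_char lE root_prod_XsubC.
have N0 : \prod_(x <- l) (M - x%:M) = 0.
  rewrite -[RHS](Cayley_Hamilton M) lE rmorph_prod; apply: eq_bigr => x _.
  by rewrite rmorphB /= horner_mx_X horner_mx_C.
have ls : size l = n.+1.
  by have := size_char_poly M; rewrite lE size_prod_XsubC => -[].
pose F (k : 'I_(size l)) z := (\prod_(x <- take k l) (M - x%:M)) i j *
  (\prod_(x <- take k.+1 l) (z - x)^-1).
have av x : x \in l -> avoids G x by move=> /lP /eigM [].
have E k t : invmx ((@curve R G k t)%:M - M) i j = \sum_m F m (@curve R G k t).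
  rewrite (@resolvent_newton _ M l (@curve R G k t))//; last first.
    by move=> x /av.
  rewrite N0 mul0mx scaler0 addr0 summxE; apply: eq_bigr => m _.
  by rewrite mxE mulrC.
have cP m : continuous_along G (fun z => \prod_(x <- take m l) (z - x)^-1).
  by apply: avoids_prod_continuous => // x /mem_take; exact: av.
have cF m : continuous_along G (F m).
  by move=> k; apply: path_continuousM; [exact: path_continuous_cst|exact: cP].
split.
  by move=> k; apply: eq_path_continuous (path_continuous_sum _ (fun m => cF m k)) => t;
    rewrite E.
have l0 : (0 < size l)%N by rewrite ls.
transitivity (contour_integral G (fun z => \sum_m F m z)).
  exact: eq_contour_integral E.
rewrite contour_integral_sum// (bigD1 (Ordinal l0))//= big1 ?addr0 => [|m m0]; rewrite contour_integralZ//.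
- rewrite take0 big_nil mxE (@contour_integral_poles _ _ regG w)//.
  + by rewrite size_takel ?ls// mulr_natl; case: eqP.
  + by rewrite size_takel ?ls.
  + by move=> x /mem_take /lP /eigM.
- rewrite (@contour_integral_poles _ _ regG w)//.
  + have -> : size (take m.+1 l) = m.+1 by rewrite size_takel.
    by rewrite eqSS -[m == 0 :> nat]/(m == Ordinal l0) (negPf m0) mulr0.
  + by rewrite size_takel.
  + by move=> x /mem_take /lP /eigM.
Qed.

End Regular.
End ResolventIntegrals.

(** * The principal square root along a contour *)

Section SquareRootCalculus.
Context {R : realType}.
Implicit Types (x y z w : R[i]) (c v : R -> R[i]).

Lemma slitP z : reflect (complex.Im z = 0 -> 0 < complex.Re z) (~~ (z <= 0)).
Proof.
case: z => a b; rewrite lecE negb_and -ltNge /= [0 == b]eq_sym.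
apply: (iffP orP) => [[/negP b0 e|//]|H]; first by case: b0; apply/eqP.
by have [/H|] := eqVneq b 0; [right|left].
Qed.

Lemma slit_neq0 z : ~~ (z <= 0) -> z != 0.
Proof. by apply: contra => /eqP ->. Qed.

Lemma Re_sqrtc z : complex.Re (sqrtc z) =
  Num.sqrt ((Num.sqrt (complex.Re z ^+ 2 + complex.Im z ^+ 2) + complex.Re z) / 2).
Proof. by case: z. Qed.

Lemma slit_norm_Re_gt0 z : ~~ (z <= 0) ->
  0 < (Num.sqrt (complex.Re z ^+ 2 + complex.Im z ^+ 2) + complex.Re z) / 2.
Proof.
move=> /slitP; case: z => a b /= H; rewrite divr_gt0// ltNge; apply/negP => h.
have r0 := sqrtr_ge0 (a ^+ 2 + b ^+ 2).
have rr : Num.sqrt (a ^+ 2 + b ^+ 2) ^+ 2 = a ^+ 2 + b ^+ 2.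
  by rewrite sqr_sqrtr// addr_ge0 ?sqr_ge0.
have b0 : b ^+ 2 <= 0.
  move: rr h r0; move: (Num.sqrt _) => r rr h r0.
  have : r ^+ 2 <= a ^+ 2 by nra.
  by rewrite rr; lra.
have /eqP : b ^+ 2 == 0 by rewrite eq_le b0 sqr_ge0.
by move=> /eqP; rewrite sqrf_eq0 => /eqP /H; lra.
Qed.

Lemma Re_sqrtc_gt0 z : ~~ (z <= 0) -> 0 < complex.Re (sqrtc z).
Proof. by move=> H; rewrite Re_sqrtc sqrtr_gt0 slit_norm_Re_gt0. Qed.

Lemma sqrtcM z : sqrtc z * sqrtc z = z.
Proof. by rewrite -expr2 sqr_sqrtc. Qed.

(** Imaginary parts are compared in [w * w = z]. This trades the choice of sign in [sqrtc] for a
    quotient that can be differentiated. *)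
Lemma Im_sqrtc z : ~~ (z <= 0) ->
  complex.Im (sqrtc z) = complex.Im z / (2 * complex.Re (sqrtc z)).
Proof.
move=> /Re_sqrtc_gt0 /gt_eqF /negbT w0; rewrite -{2}(sqrtcM z) ReImE.
by move: w0; move: (complex.Re _) (complex.Im _) => a b a0; field.
Qed.

Lemma is_derive_sqrtf (f : R -> R) f' (t : R) : 0 < f t ->
  is_derive t 1 f f' ->
  is_derive t 1 (fun s => Num.sqrt (f s)) (f' / (2 * Num.sqrt (f t))).
Proof.
move=> f0 a; have ab := @is_derive1_comp _ _ f _ _ _ (is_derive1_sqrt f0) a.
by apply: (is_derive_eq ab); rewrite mulrC.
Qed.

Lemma is_derive_lnf (f : R -> R) f' (t : R) : 0 < f t ->
  is_derive t 1 f f' -> is_derive t 1 (fun s => ln (f s)) (f' / f t).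
Proof.
move=> f0 a; have ab := @is_derive1_comp _ _ f _ _ _ (is_derive1_ln f0) a.
by apply: (is_derive_eq ab); rewrite mulrC.
Qed.

Lemma is_derive_atanf (f : R -> R) f' (t : R) :
  is_derive t 1 f f' -> is_derive t 1 (fun s => atan (f s)) (f' / (1 + f t ^+ 2)).
Proof.
move=> a; have ab := @is_derive1_comp _ _ f _ _ _ (is_derive1_atan (f t)) a.
by apply: (is_derive_eq ab); rewrite mulrC.
Qed.

(** The real formulas only serve to show that some derivative [v] exists; its value follows by
    differentiating [sqrtc (c t) * sqrtc (c t) = c t]. *)
Lemma path_derivative_sqrtc c c' : path_derivative c c' ->
  (forall t, ~~ (c t <= 0)) ->
  path_derivative (fun t => sqrtc (c t)) (fun t => c' t / (2 * sqrtc (c t))).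
Proof.
move=> dc sl.
have [v dv] : exists v, path_derivative (fun t => sqrtc (c t)) v.
  suff H (t : R) : exists v : R[i],
      is_derive t 1 (fun s => complex.Re (sqrtc (c s))) (complex.Re v) /\
      is_derive t 1 (fun s => complex.Im (sqrtc (c s))) (complex.Im v).
    by have [v vP] := choice H; exists v => t.
  have [a b] := dc t; have n0 := sqr_norm_neq0 (slit_neq0 (sl t)).
  have n1 : 0 < complex.Re (c t) ^+ 2 + complex.Im (c t) ^+ 2.
    by rewrite lt_neqAle eq_sym n0 addr_ge0 ?sqr_ge0.
  have n2 := slit_norm_Re_gt0 (sl t).
  have d1 := @is_derive_sqrtf
    (fun s => complex.Re (c s) ^+ 2 + complex.Im (c s) ^+ 2) _ t n1
    (is_derive_addf (is_derive_sqrf a) (is_derive_sqrf b)).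
  have d2 := @is_derive_mulf _ _ _ _ _ _ (is_derive_addf d1 a)
    (is_derive_cst (2^-1 : R) t 1).
  have := @is_derive_sqrtf (fun s => (Num.sqrt (complex.Re (c s) ^+ 2 +
    complex.Im (c s) ^+ 2) + complex.Re (c s)) / 2) _ t n2 d2.
  move: (_ / (2 * Num.sqrt _)) => r dr.
  have {}dr : is_derive t 1 (fun s => complex.Re (sqrtc (c s))) r.
    by under eq_fun do rewrite Re_sqrtc.
  have {}n0 : 2 * complex.Re (sqrtc (c t)) != 0.
    by rewrite mulf_neq0// gt_eqF// Re_sqrtc_gt0.
  have di := is_derive_mulf b (@is_derive_invf _
     (fun s => 2 * complex.Re (sqrtc (c s))) _ t n0
     (is_derive_mulf (is_derive_cst (2 : R) t 1) dr)).
  move: (_ + _ : R) di => q di; exists (r +i* q); split => //=.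
  under eq_fun do rewrite Im_sqrtc//.
  exact: di.
have e : c' = (fun t => v t * sqrtc (c t) + sqrtc (c t) * v t).
  rewrite -(velocityE dc) -(velocityE (path_derivativeM dv dv)).
  by congr velocity; apply/funext => t; rewrite sqrtcM.
apply: eq_path_derivative dv => t; rewrite e.
have w0 : sqrtc (c t) != 0 by rewrite sqrtc_eq0 slit_neq0.
by field.
Qed.

(** The principal logarithm on the half-plane [Re z > 0], where the arctangent of the slope is the
    argument. *)
Definition right_log z : R[i] :=
  (ln (complex.Re z ^+ 2 + complex.Im z ^+ 2) / 2) +i* atan (complex.Im z / complex.Re z).

Lemma path_derivative_right_log v v' : path_derivative v v' ->
  (forall t, 0 < complex.Re (v t)) ->
  path_derivative (fun t => right_log (v t)) (fun t => v' t / v t).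
Proof.
move=> dv pos t; have [a b] := dv t.
have a0 : complex.Re (v t) != 0 by rewrite gt_eqF.
have n1 : 0 < complex.Re (v t) ^+ 2 + complex.Im (v t) ^+ 2.
  by rewrite ltr_wpDr ?sqr_ge0// exprn_gt0.
have d1 := @is_derive_mulf _ _ _ _ _ _ (@is_derive_lnf
   (fun s => complex.Re (v s) ^+ 2 + complex.Im (v s) ^+ 2) _ t n1
   (is_derive_addf (is_derive_sqrf a) (is_derive_sqrf b)))
   (is_derive_cst (2^-1 : R) t 1).
have d2 := is_derive_atanf (is_derive_mulf b (@is_derive_invf _
  (fun s => complex.Re (v s)) _ t a0 a)).
have {}n1 := lt0r_neq0 n1.
split.
  apply: (is_derive_eq d1); rewrite !ReImE /cst.
  by move: n1 a0; move: (complex.Re (v t)) (complex.Im (v t)) => p q n1 a0; field.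
apply: (is_derive_eq d2); rewrite !ReImE.
move: n1 a0; move: (complex.Re (v t)) (complex.Im (v t)) => p q n1 a0; field.
by rewrite n1 a0.
Qed.

Lemma contour_integral_right_half_plane (G : contour R) x : regular_contour G ->
  (forall k t, 0 < complex.Re (@curve R G k t - x)) ->
  contour_integral G (fun z => (z - x)^-1) = 0.
Proof.
move=> regG pos; apply: (@contour_integral_primitive _ _ regG (fun z => right_log (z - x))).
  apply: avoids_inv_continuous => // k t.
  by apply: contraTneq (pos k t) => ->; rewrite subrr ltxx.
move=> k; have [_ dc _] := regG k.
apply: eq_path_derivative (path_derivative_right_log
  (path_derivativeD dc (path_derivative_cst (- x))) (pos k)) => t.
by rewrite addr0 mulrC.
Qed.

Definition sqrt_of_contour (G : contour R) : contour R :=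
  Contour (fun k t => sqrtc (@curve R G k t)).

Section SquareRootOfContour.
Variables (G : contour R) (regG : regular_contour G).
Hypothesis slitG : forall k t, ~~ (@curve R G k t <= 0).

Let sqrt_neq0 k t : sqrtc (@curve R G k t) != 0.
Proof. by rewrite sqrtc_eq0 slit_neq0. Qed.

Lemma sqrt_of_contour_regular : regular_contour (sqrt_of_contour G).
Proof.
move=> k; have [c01 dc cv] := regG k.
have ds := path_derivative_sqrtc dc (slitG k).
split; rewrite /= ?c01// (velocityE ds)//.
apply: path_continuousM => //; apply: path_continuousV => [|t].
  apply: path_continuousM; first exact: path_continuous_cst.
  exact: path_derivative_continuous ds.
by rewrite mulf_neq0.
Qed.

(* The substitution [w = sqrt z]. *)
Lemma contour_integral_sqrt (h : R[i] -> R[i]) :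
  contour_integral G (fun z => h (sqrtc z)) =
  contour_integral (sqrt_of_contour G) (fun w => 2 * w * h w).
Proof.
apply: eq_bigr => k _; have [_ dc _] := regG k.
have ds := path_derivative_sqrtc dc (slitG k).
rewrite -[LHS]/(path_integral _) -[RHS]/(path_integral _).
apply: eq_path_integral => t /=; rewrite (velocityE ds).
by have := sqrt_neq0 k t; move: (sqrtc _) (velocity _ _) (h _) => u v a u0; field.
Qed.

(** It comes from [z - M = (w + T) (w - T)] with [w = sqrtc z], which also yields the invertibility
    of [w + T]. The form [w - - T] displays the last term as a resolvent of [- T], to which
    [contour_integral_resolvent] applies. *)
Lemma sqrt_resolventD d (M T : 'M[R[i]]_d) k t : T *m T = M ->
  (forall x, eigenvalue M x -> avoids G x) ->
  let z := @curve R G k t in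
  sqrtc z *: invmx (z%:M - M) = T *m invmx (z%:M - M) + invmx ((sqrtc z)%:M - - T).
Proof.
move=> TM aM z; have := avoids_resolvent_unit k t aM; rewrite -/z => unitM.
rewrite opprK; set w := sqrtc z.
have fac : (w%:M + T) *m (w%:M - T) = z%:M - M.
  rewrite mulmxDl !mulmxBr -scalar_mxM sqrtcM TM scalar_mxC addrA subrK//.
have inv1 : (w%:M + T) *m ((w%:M - T) *m invmx (z%:M - M)) = 1%:M.
  by rewrite mulmxA fac mulmxV.
have [unitT _] := mulmx1_unit inv1.
have -> : invmx (w%:M + T) = (w%:M - T) *m invmx (z%:M - M).
  by rewrite -[RHS](mulKmx unitT) inv1 mulmx1.
by rewrite mulmxBl addrCA subrr addr0 mul_scalar_mx.
Qed.

End SquareRootOfContour.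

Lemma two_pi_i_neq0 : (two_pi_i : R[i]) != 0.
Proof.
rewrite /two_pi_i; apply: mulf_neq0.
  by rewrite fmorph_eq0 mulf_neq0 ?pnatr_eq0// gt_eqF// pi_gt0.
by rewrite eq_complex /= negb_and oner_eq0 orbT.
Qed.

Lemma holomorphic_sqrt_eq (G : contour R) d (M T : 'M[R[i]]_d) :
  regular_contour G -> (forall k t, ~~ (@curve R G k t <= 0)) ->
  T *m T = M ->
  (forall x, eigenvalue M x -> avoids G x /\ winding_number G x = 1) ->
  (forall x, eigenvalue T x -> 0 < complex.Re x) ->
  holomorphic_sqrt G M = T.
Proof.
move=> regG slitG TM eigM eigT.
have regS := sqrt_of_contour_regular regG slitG.
have eigM' x : eigenvalue M x ->
    avoids G x /\ contour_integral G (fun z => (z - x)^-1) = two_pi_i.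
  move=> /eigM [ax]; rewrite /winding_number => w1; split=> //.
  by rewrite -[LHS](mulKf two_pi_i_neq0) mulrCA w1 mulr1.
have aM x : eigenvalue M x -> avoids G x by move=> /eigM [].
(* The eigenvalues of [- T] lie in the open left half-plane and the image contour in the right
   one. *)
have eigNT x : eigenvalue (- T) x -> avoids (sqrt_of_contour G) x /\
    contour_integral (sqrt_of_contour G) (fun z => (z - x)^-1) = 0.
  move=> /eigenvalueP [v vT v0].
  have /eigT : eigenvalue T (- x).
    by apply/eigenvalueP; exists v => //; rewrite scaleNr -vT mulmxN opprK.
  rewrite ReImE => Nx0.
  have pos k t : 0 < complex.Re (sqrtc (@curve R G k t) - x).
    by rewrite !ReImE addr_gt0// Re_sqrtc_gt0.
  split; last exact: contour_integral_right_half_plane.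
  by move=> k t; apply: contraTneq (pos k t) => /= ->; rewrite subrr ltxx.
have IM := contour_integral_resolvent _ _ _ eigM'.
have IT := contour_integral_resolvent _ _ _ eigNT.
apply/matrixP => i j; rewrite mxE.
have [cS _] := IT regS i j; pose h w := invmx (w%:M - - T) i j.
have ch : continuous_along (sqrt_of_contour G) h by [].
have TcM l : continuous_along G (fun z => T i l * invmx (z%:M - M) l j).
  move=> k; apply: path_continuousM; first exact: path_continuous_cst.
  by have [/(_ k)] := IM regG l j.
(* Here [2 w / (w + T) = 2 - 2 T / (w + T)]: the constant has a linear primitive, and the resolvent
   of [- T] integrates to 0. *)
have Is : contour_integral (sqrt_of_contour G) (fun w => 2 * w * h w) = 0.
  pose Q w := \sum_l T i l * invmx (w%:M - - T) l j.
  have TcT l : continuous_along (sqrt_of_contour G)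
      (fun z => T i l * invmx (z%:M - - T) l j).
    move=> k; apply: path_continuousM; first exact: path_continuous_cst.
    by have [/(_ k)] := IT regS l j.
  have cQ : continuous_along (sqrt_of_contour G) Q.
    by move=> k; apply: path_continuous_sum => l; apply: TcT.
  have cc : continuous_along (sqrt_of_contour G) (fun=> 2 *+ (i == j) : R[i]).
    by move=> k; exact: path_continuous_cst.
  transitivity (contour_integral (sqrt_of_contour G)
      (fun w => 2 *+ (i == j) + (- 2) * Q w)).
    apply: eq_contour_integral => k t; rewrite /h /Q /=.
    have aT x : eigenvalue (- T) x -> avoids (sqrt_of_contour G) x by move=> /eigNT [].
    have unitT := avoids_resolvent_unit k t aT; rewrite /= in unitT.
    have /matrixP /(_ i j) := mulmxV unitT; rewrite opprK in unitT *.
    rewrite mulmxDl mul_scalar_mx !mxE => e.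
    by rewrite -[2 *+ _]mulr_natr -e; ring.
  rewrite contour_integralD//; last first.
    by move=> k; apply: path_continuousM; [exact: path_continuous_cst|exact: cQ].
  rewrite contour_integralZ// contour_integral_sum//.
  rewrite big1 ?mulr0 ?addr0; last first.
    move=> l _; rewrite contour_integralZ//; last by have [] := IT regS l j.
    by have [_ ->] := IT regS l j; rewrite mul0rn mulr0.
  apply: (@contour_integral_primitive _ _ regS (fun w => 2 *+ (i == j) * w)) => //.
  move=> k; have [_ dc _] := regS k.
  apply: eq_path_derivative (path_derivativeM (path_derivative_cst _) dc) => t.
  by rewrite mul0r add0r.
transitivity (two_pi_i^-1 * contour_integral G
   (fun z => \sum_l T i l * invmx (z%:M - M) l j + h (sqrtc z))).
  congr (_ * _); apply: eq_contour_integral => k t.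
  have /matrixP /(_ i j) := sqrt_resolventD k t TM aM.
  by rewrite !mxE.
rewrite contour_integralD//.
- rewrite contour_integral_sqrt// Is addr0 contour_integral_sum// (bigD1 j)//=.
  rewrite big1 => [|l lj]; rewrite contour_integralZ//.
  + by have [_ ->] := IM regG j j; rewrite eqxx addr0 mulrCA mulVf ?two_pi_i_neq0 ?mulr1.
  + by have [] := IM regG j j.
  + by have [_ ->] := IM regG l j; rewrite (negPf lj) mulr0.
  + by have [] := IM regG l j.
- by move=> k; apply: path_continuous_sum => l; apply: TcM.
Qed.

End SquareRootCalculus.

(** * Real symmetric matrices *)

Section MatrixNorm.
Context {R : realType}.

Lemma entry_le_norm m n (A : 'M[R]_(m, n)) i j : `|A i j| <= `|A|.
Proof.
rewrite -[`|A|]/(mx_norm A) mx_normrE.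
exact: (le_bigmax _ (fun ij => `|A ij.1 ij.2|) (i, j)).
Qed.

Lemma norm_le_entries m n (A : 'M[R]_(m, n)) c : 0 <= c ->
  (forall i j, `|A i j| <= c) -> `|A| <= c.
Proof.
move=> c0 H; rewrite -[`|A|]/(mx_norm A) mx_normrE.
by apply: bigmax_le => // -[i j] _; exact: H.
Qed.

(** The sup norm is submultiplicative only up to the number of terms in an entry of the product;
    this is the origin of the factors [d%:R] in the constants below. *)
Lemma norm_mulmx m n p (A : 'M[R]_(m, n)) (B : 'M[R]_(n, p)) :
  `|A *m B| <= n%:R * `|A| * `|B|.
Proof.
apply: norm_le_entries => [|i j]; first by rewrite !mulr_ge0.
rewrite mxE (le_trans (ler_norm_sum _ _ _))//.
rewrite -mulrA mulr_natl -[X in _ *+ X](card_ord n) -sumr_const ler_sum// => k _.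
by rewrite normrM ler_pM ?entry_le_norm.
Qed.

Lemma norm_mxtrace n (A : 'M[R]_n) : `|\tr A| <= n%:R * `|A|.
Proof.
rewrite (le_trans (ler_norm_sum _ _ _))//.
rewrite mulr_natl -[X in _ *+ X](card_ord n) -sumr_const ler_sum// => k _.
exact: entry_le_norm.
Qed.

End MatrixNorm.

Section RealSpectralTheorem.
Context {R : realType}.

Lemma symmetric_eigenvalue_real d (A : 'M[R]_d) (z : R[i]) :
  A^T = A -> eigenvalue (complex_mx A) z -> complex.Im z = 0.
Proof.
move=> Asym /eigenvalueP [v vA v0].
pose vc := (map_mx conjc v)^T.
(* The conjugate transpose of a left eigenvector is a right one for the conjugate eigenvalue; then
   [v *m complex_mx A *m vc] is computed in two ways. *)
have vcE : complex_mx A *m vc = z^*%C *: vc.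
  rewrite /vc -[complex_mx A]trmxK -trmx_mul -[in RHS]linearZ; congr (_^T).
  have -> : (complex_mx A)^T = map_mx conjc (complex_mx A).
    by rewrite -{1}Asym; apply/matrixP => i j; rewrite !mxE conjc_real.
  by rewrite -map_mxM /= vA map_mxZ.
have e : z *: (v *m vc) = z^*%C *: (v *m vc).
  by rewrite scalemxAl -vA -mulmxA vcE scalemxAr.
have n0 : (v *m vc) 0 0 != 0.
  rewrite mxE; apply/negP => /eqP/psumr_eq0P H.
  case/eqP: v0; apply/rowP => i; rewrite mxE.
  have /H/(_ i isT) : forall i : 'I_d, xpredT i -> 0 <= v 0 i * vc i 0.
    by move=> k _; rewrite !mxE mulcJ_ge0.
  by rewrite !mxE => /eqP; rewrite mulf_eq0 conjc_eq0 orbb => /eqP.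
have /matrixP/(_ 0 0) := e; rewrite [in LHS]mxE [in RHS]mxE => /(mulIf n0).
by case: z {vA vcE e n0} => a b /= [] /eqP; rewrite -addr_eq0 -mulr2n mulrn_eq0 => /eqP.
Qed.

(** A complex eigenvalue exists and is real, hence a root of the real characteristic polynomial,
    which provides a real eigenvector. *)
Lemma symmetric_eigenvector d (A : 'M[R]_d.+1) : A^T = A ->
  exists (a : R) (v : 'rV[R]_d.+1), v *m v^T = 1%:M /\ v *m A = a *: v.
Proof.
move=> Asym; have [z ez] := eigenvalue_closed (complex_mx A) (ltn0Sn d).
have z0 := symmetric_eigenvalue_real Asym ez.
have ea : eigenvalue A (complex.Re z).
  move: ez; rewrite !eigenvalue_root_char -map_char_poly.
  have -> : z = (complex.Re z)%:C by case: z z0 => a b /= ->.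
  by rewrite fmorph_root.
have [v vA v0] := eigenvalueP ea; exists (complex.Re z).
have vv : 0 < (v *m v^T) 0 0.
  rewrite mxE lt_neqAle sumr_ge0 ?andbT => [|i _]; last by rewrite mxE -expr2 sqr_ge0.
  rewrite eq_sym; apply: contra v0 => /eqP/psumr_eq0P H; apply/eqP/rowP => i.
  have /H/(_ i isT) : forall i, xpredT i -> 0 <= v 0 i * v^T i 0.
    by move=> k _; rewrite mxE -expr2 sqr_ge0.
  by rewrite !mxE -expr2 => /eqP; rewrite sqrf_eq0 => /eqP.
set q := (v *m v^T) 0 0 in vv; exists ((Num.sqrt q)^-1 *: v); split.
  rewrite linearZ /= -scalemxAl -scalemxAr scalerA [v *m v^T]mx11_scalar -/q.
  by rewrite scale_scalar_mx -invfM -expr2 sqr_sqrtr ?ltW// mulVf// gt_eqF.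
by rewrite -scalemxAl vA scalerA mulrC -scalerA.
Qed.

(* Householder: the reflection along [v - e_0]. *)
Lemma orthogonal_first_row d (v : 'rV[R]_d.+1) : v *m v^T = 1%:M ->
  exists H : 'M[R]_d.+1, H *m H^T = 1%:M /\ row 0 H = v.
Proof.
move=> vv; pose e := delta_mx 0 0 : 'rV[R]_d.+1.
have [ve|ve] := eqVneq v e.
  by exists 1%:M; rewrite trmx1 mulmx1 row1 ve.
pose u := v - e; pose v0 := v 0 0.
have ee : e *m e^T = 1%:M.
  rewrite /e trmx_delta mul_delta_mx; apply/matrixP => i j.
  by rewrite !mxE !ord1.
have evT : e *m v^T = v0%:M.
  rewrite -rowE; apply/matrixP => i j; rewrite !mxE !ord1 /= mulr1n.
  by rewrite /v0.
have veT : v *m e^T = v0%:M by rewrite -[LHS]trmxK trmx_mul trmxK evT tr_scalar_mx.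
have uu : u *m u^T = (2 - 2 * v0)%:M.
  rewrite /u linearB /= mulmxBl !mulmxBr vv ee evT veT -!raddfB /=; congr (_%:M).
  by ring.
have n0 : 2 - 2 * v0 != 0.
  apply: contra ve => /eqP h; rewrite -subr_eq0 -/u.
  move: uu; rewrite h => /matrixP/(_ 0 0); rewrite !mxE mul0rn => /psumr_eq0P H.
  apply/eqP/rowP => i; rewrite [RHS]mxE.
  have /H/(_ i isT) : forall i, xpredT i -> 0 <= u 0 i * u^T i 0.
    by move=> k _; rewrite [u^T _ _]mxE -expr2 sqr_ge0.
  by rewrite [u^T _ _]mxE -expr2 => /eqP; rewrite sqrf_eq0 => /eqP.
have uE : u = v - e by []; clearbody u.
(* [k] is [2 / |u|^2], so [H] is the reflection in the hyperplane orthogonal to [u]. *)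
pose k := 2 / (2 - 2 * v0); pose H := 1%:M - k *: (u^T *m u).
exists H.
have HT : H^T = H by rewrite /H linearB /= trmx1 linearZ /= trmx_mul trmxK.
split.
  rewrite HT /H mulmxBl mul1mx mulmxBr mulmx1 -scalemxAl -scalemxAr scalerA.
  have -> : u^T *m u *m (u^T *m u) = (2 - 2 * v0) *: (u^T *m u).
    by rewrite -mulmxA (mulmxA u) uu mul_scalar_mx -scalemxAr.
  have kk : k * k * (2 - 2 * v0) = k + k by rewrite /k; field.
  by rewrite scalerA kk scalerDl opprB addrK subrK.
rewrite rowE -/e /H mulmxBr mulmx1 -scalemxAr mulmxA.
have -> : e *m u^T = (v0 - 1)%:M by rewrite uE linearB /= mulmxBr evT ee -raddfB.
rewrite mul_scalar_mx scalerA.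
have -> : k * (v0 - 1) = -1 by rewrite /k; field.
by rewrite scaleN1r opprK uE addrC subrK.
Qed.

Lemma symmetric_diagonalization d (A : 'M[R]_d) : A^T = A ->
  exists (P : 'M[R]_d) (l : 'rV[R]_d),
    P *m P^T = 1%:M /\ A = P^T *m diag_mx l *m P.
Proof.
elim: d A => [|d IH] A Asym.
  by exists 1%:M, 0; rewrite trmx1 mulmx1; split=> //; apply/matrixP => -[].
have [a [v [vv vA]]] := symmetric_eigenvector Asym.
have [H [HH rH]] := orthogonal_first_row vv.
have HH' := mulmx1C HH.
(* In an orthonormal basis that starts with the eigenvector, the first row is diagonal, and by
   symmetry so is the first column: [B] splits into blocks. *)
pose B : 'M[R]_(1 + d) := H *m A *m H^T.
have Bsym : B^T = B by rewrite /B !trmx_mul trmxK Asym mulmxA.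
have rB : row 0 B = a *: delta_mx 0 0.
  by rewrite /B -mulmxA row_mul rH mulmxA vA -scalemxAl -rH -row_mul HH row1.
have l0 : lshift d (0 : 'I_1) = 0 by apply: val_inj.
have ur : ursubmx B = 0.
  apply/matrixP => i j; have := congr1 (fun w : 'rV_d.+1 => w 0 (rshift 1 j)) rB.
  rewrite [LHS]mxE ord1 !mxE l0 => ->.
  by have /negPf -> : rshift 1 j != 0 :> 'I_d.+1 by []; rewrite andbF mulr0.
have ul : ulsubmx B = a%:M.
  apply/matrixP => i j; have := congr1 (fun w : 'rV_d.+1 => w 0 0) rB.
  by rewrite [LHS]mxE !ord1 !mxE l0 => ->; rewrite eqxx mulr1.
have dl : dlsubmx B = 0.
  by rewrite -[dlsubmx B]trmxK trmx_dlsub Bsym ur trmx0.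
have dr : (drsubmx B)^T = drsubmx B by rewrite trmx_drsub Bsym.
have [P' [l' [PP' BE]]] := IH _ dr.
have BB : B = block_mx a%:M 0 0 (drsubmx B) by rewrite -[LHS]submxK ul ur dl.
pose P : 'M[R]_(1 + d) := block_mx 1%:M 0 0 P'.
have PT : P^T = block_mx 1%:M 0 0 P'^T by rewrite /P tr_block_mx !trmx0 trmx1.
have PPT : P *m P^T = 1%:M.
  rewrite PT /P mulmx_block !mulmx0 !mul0mx !addr0 !add0r PP' mulmx1.
  by rewrite -scalar_mx_block.
have PDP : P^T *m (diag_mx (row_mx a%:M l') *m P) = B.
  rewrite diag_mx_row PT /P !mulmx_block.
  rewrite !mulmx0 !mul0mx !mulmx1 !mul1mx !addr0 !add0r mulmxA -BE [RHS]BB.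
  congr (block_mx _ _ _ _); last by rewrite mulmx0.
  by apply/matrixP => i j; rewrite !mxE !ord1.
exists (P *m H), (row_mx a%:M l'); split.
  by rewrite trmx_mul -mulmxA (mulmxA H) HH mul1mx PPT.
rewrite trmx_mul !mulmxA -(mulmxA _ _ P) -(mulmxA _ P^T) PDP.
by rewrite /B !mulmxA HH' mul1mx -mulmxA HH' mulmx1.
Qed.

End RealSpectralTheorem.

(** * The Sylvester equation and nearby square roots *)

Section PositivelyDiagonalizable.
Context {R : realType}.

(** [Q] is invertible but not orthogonal, so that the class is stable under conjugation: the square
    root of [A B] to be studied is a conjugate of a positive definite matrix and in general not
    symmetric. *)
Definition posdiag d (U : 'M[R]_d) := exists (Q : 'M[R]_d) (s : 'rV[R]_d),
  [/\ Q \in unitmx, forall i, 0 < s 0 i & U = invmx Q *m diag_mx s *m Q].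

Lemma orthogonal_inv d (P : 'M[R]_d) : P *m P^T = 1%:M ->
  P \in unitmx /\ invmx P = P^T.
Proof.
move=> PP; have [uP _] := mulmx1_unit PP; split=> //.
by rewrite -[RHS](mulKmx uP) PP mulmx1.
Qed.

Lemma spd_congruence d (A C : 'M[R]_d) : spd A -> C \in unitmx ->
  spd (C *m A *m C^T).
Proof.
move=> [Asym Apos] uC; split; first by rewrite !trmx_mul trmxK Asym mulmxA.
move=> x x0; have -> : x *m (C *m A *m C^T) *m x^T = (x *m C) *m A *m (x *m C)^T.
  by rewrite trmx_mul !mulmxA.
apply: Apos; apply: contra x0 => /eqP e.
by rewrite -[x](mulmxK uC) e mul0mx.
Qed.

Lemma spd_diag_gt0 d (P : 'M[R]_d) (l : 'rV[R]_d) : P *m P^T = 1%:M ->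
  spd (P^T *m diag_mx l *m P) -> forall i, 0 < l 0 i.
Proof.
move=> PP spdA i; have [uP _] := orthogonal_inv PP.
have [_ /(_ (delta_mx 0 i))] := spd_congruence spdA uP.
have -> : P *m (P^T *m diag_mx l *m P) *m P^T = diag_mx l.
  by rewrite !mulmxA PP mul1mx -mulmxA PP mulmx1.
rewrite -rowE => H.
have /H : delta_mx 0 i != 0 :> 'rV[R]_d.
  by apply/negP => /eqP/matrixP/(_ 0 i)/eqP; rewrite !mxE !eqxx oner_eq0.
by rewrite trmx_delta -colE !mxE eqxx mulr1n.
Qed.

Lemma spd_posdiag d (A : 'M[R]_d) : spd A -> posdiag A.
Proof.
move=> spdA; have [P [l [PP AE]]] := symmetric_diagonalization spdA.1.
have [uP iP] := orthogonal_inv PP.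
exists P, l; split=> //; last by rewrite iP.
by apply: spd_diag_gt0 PP _; rewrite -AE.
Qed.

Lemma spd_sqrt d (A : 'M[R]_d) : spd A ->
  spd (spectral_sqrt A) /\ spectral_sqrt A *m spectral_sqrt A = A.
Proof.
move=> spdA; have : is_spectral_sqrt A (spectral_sqrt A).
  apply: getPex; have [P [l [PP AE]]] := symmetric_diagonalization spdA.1.
  exists (P^T *m diag_mx (map_mx Num.sqrt l) *m P), P, l; split=> // i.
  by apply/ltW/(spd_diag_gt0 PP); rewrite -AE.
(* [spectral_sqrt] is a chosen witness; this diagonalization may differ from the one that proved
   existence. *)
move=> [P [l [PP _ AE SE]]]; have [uP iP] := orthogonal_inv PP.
have l0 : forall i, 0 < l 0 i by apply: spd_diag_gt0 PP _; rewrite -AE.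
have s0 i : 0 < map_mx Num.sqrt l 0 i by rewrite mxE sqrtr_gt0.
split; last first.
  rewrite {1}SE {1}SE [RHS]AE !mulmxA -(mulmxA _ P) PP mulmx1 -(mulmxA _ _ (diag_mx _)).
  rewrite mulmx_diag; congr (_ *m diag_mx _ *m _).
  by apply/rowP => i; rewrite !mxE -expr2 sqr_sqrtr// ltW.
rewrite SE -[X in spd (_ *m X)]trmxK; apply: spd_congruence; last by rewrite unitmx_tr.
split; first exact: tr_diag_mx.
move=> x x0; rewrite mul_mx_diag mxE lt_neqAle sumr_ge0 ?andbT => [|i _]; last first.
  by rewrite !mxE mulrAC -expr2 mulr_ge0 ?sqr_ge0 ?sqrtr_ge0.
rewrite eq_sym; apply: contra x0 => /eqP/psumr_eq0P H; apply/eqP/rowP => i.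
have /H/(_ i isT) : forall i, xpredT i ->
    0 <= (\matrix_(i, j) (x i j * map_mx Num.sqrt l 0 j)) 0 i * x^T i 0.
  by move=> k _; rewrite !mxE mulrAC -expr2 mulr_ge0 ?sqr_ge0 ?sqrtr_ge0.
move: (s0 i); rewrite !mxE mulrAC -expr2 => si /eqP.
by rewrite mulf_eq0 (gt_eqF si) orbF sqrf_eq0 => /eqP.
Qed.

Lemma posdiag_conj d (U C : 'M[R]_d) : posdiag U -> C \in unitmx ->
  posdiag (C *m U *m invmx C).
Proof.
move=> [Q [s [uQ s0 ->]]] uC; exists (Q *m invmx C), s; split=> //.
  by rewrite unitmx_mul uQ unitmx_inv.
have -> : invmx (Q *m invmx C) = C *m invmx Q.
  rewrite -[LHS]mulmx1 -[RHS](mulKmx (_ : Q *m invmx C \in unitmx)); last first.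
    by rewrite unitmx_mul uQ unitmx_inv.
  by congr (_ *m _); rewrite mulmxA mulmxKV// mulmxV.
by rewrite !mulmxA.
Qed.

Lemma posdiag_unit d (U : 'M[R]_d) : posdiag U -> U \in unitmx.
Proof.
move=> [Q [s [uQ s0 ->]]]; rewrite !unitmx_mul unitmx_inv uQ andbT /=.
by rewrite unitmxE det_diag unitfE; apply/prodf_neq0 => i _; rewrite gt_eqF.
Qed.

End PositivelyDiagonalizable.

Section Sylvester.
Context {R : realType} {d : nat}.
Implicit Types (X Y U V W H M : 'M[R]_d) (f g : 'M[R]_d -> 'M[R]_d).

Definition bounded_op f := exists2 c : R, 0 <= c & forall X, `|f X| <= c * `|X|.

Lemma bounded_op_comp f g : bounded_op f -> bounded_op g -> bounded_op (f \o g).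
Proof.
move=> [c c0 fc] [e e0 ge]; exists (c * e); first exact: mulr_ge0.
by move=> X /=; rewrite (le_trans (fc _))// -mulrA ler_wpM2l.
Qed.

Lemma bounded_op_mull U : bounded_op (mulmx U).
Proof. by exists (d%:R * `|U|); [rewrite mulr_ge0|move=> X; exact: norm_mulmx]. Qed.

Lemma bounded_op_mulr U : bounded_op (fun X => X *m U).
Proof.
exists (d%:R * `|U|) => [|X]; first by rewrite mulr_ge0.
by rewrite mulrAC; exact: norm_mulmx.
Qed.

Definition sylvester_inverse U (L : {linear 'M[R]_d -> 'M[R]_d}) :=
  [/\ forall X, U *m L X + L X *m U = X, forall X, L (U *m X + X *m U) = X &
      bounded_op L].

(** In an eigenbasis of [U], the map [X |-> U X + X U] multiplies the entry [(i, j)] by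
    [s i + s j > 0]. *)
Lemma sylvester_inverse_exists U : posdiag U -> exists L, sylvester_inverse U L.
Proof.
move=> [Q [s [uQ s0 UE]]].
pose D X : 'M[R]_d := \matrix_(i, j) (X i j / (s 0 i + s 0 j)).
have ss i j : s 0 i + s 0 j != 0 by rewrite gt_eqF// addr_gt0.
pose f X := invmx Q *m D (Q *m X *m invmx Q) *m Q.
have lf : linear f.
  move=> a X Y; rewrite /f mulmxDr mulmxDl -scalemxAr -scalemxAl.
  have -> : D (a *: (Q *m X *m invmx Q) + Q *m Y *m invmx Q) =
      a *: D (Q *m X *m invmx Q) + D (Q *m Y *m invmx Q).
    by apply/matrixP => i j; rewrite !mxE mulrDl mulrA.
  by rewrite mulmxDr mulmxDl -scalemxAr -scalemxAl.
pose L : {linear 'M[R]_d -> 'M[R]_d} := HB.pack f (GRing.isLinear.Build _ _ _ _ f lf).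
have LE X : L X = f X by [].
exists L; split=> [X|X|].
- rewrite !LE /f UE; set Y := Q *m X *m invmx Q.
  have -> : invmx Q *m diag_mx s *m Q *m (invmx Q *m D Y *m Q) =
      invmx Q *m (diag_mx s *m D Y) *m Q.
    by rewrite !mulmxA mulmxK.
  have -> : invmx Q *m D Y *m Q *m (invmx Q *m diag_mx s *m Q) =
      invmx Q *m (D Y *m diag_mx s) *m Q.
    by rewrite !mulmxA mulmxK.
  rewrite -mulmxDl -mulmxDr; have -> : diag_mx s *m D Y + D Y *m diag_mx s = Y.
    by apply/matrixP => i j; rewrite mul_diag_mx mul_mx_diag !mxE; field.
  by rewrite /Y !mulmxA mulVmx// mul1mx mulmxKV.
- rewrite LE /f UE; set Y := Q *m X *m invmx Q.
  have -> : Q *m (invmx Q *m diag_mx s *m Q *m X + X *m (invmx Q *m diag_mx s *m Q)) *m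
      invmx Q = diag_mx s *m Y + Y *m diag_mx s.
    rewrite mulmxDr mulmxDl !mulmxA mulmxV// mul1mx; congr (_ + _).
    by rewrite mulmxK.
  have -> : D (diag_mx s *m Y + Y *m diag_mx s) = Y.
    by apply/matrixP => i j; rewrite mul_diag_mx mul_mx_diag !mxE; field.
  by rewrite /Y !mulmxA mulVmx// mul1mx mulmxKV.
- have bD : bounded_op D.
    (* A sum of positive terms bounds each of them, without a maximum that would need a nonempty
       index set. *)
    pose c := \sum_i \sum_j (s 0 i + s 0 j)^-1.
    have p0 i j : 0 <= (s 0 i + s 0 j)^-1 by rewrite invr_ge0 ltW// addr_gt0.
    have c0 : 0 <= c by rewrite sumr_ge0// => i _; rewrite sumr_ge0.
    exists c => // X; apply: norm_le_entries => [|i j]; first by rewrite mulr_ge0.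
    rewrite mxE normrM mulrC ler_pM// ?entry_le_norm// ger0_norm//.
    rewrite /c (bigD1 i)//= (bigD1 j)//= -addrA lerDl addr_ge0// sumr_ge0// => k _.
    by rewrite sumr_ge0.
  have -> : (L : 'M[R]_d -> 'M[R]_d) =
      (fun X => X *m Q) \o (mulmx (invmx Q) \o (D \o ((fun X => X *m invmx Q) \o mulmx Q))).
    by apply/funext.
  have [bl br] := (bounded_op_mull, bounded_op_mulr).
  by do ![apply: bounded_op_comp => //].
Qed.

(** Replacing [U] by [V] on the left and [W] on the right costs two terms, each at most [|X| / 4]
    after applying [L] by the choice of [e]; half of [|X|] is absorbed, whence the factor 2. Two
    coefficients are allowed because differences of squares produce them. The [+ 1] keep the
    constants positive. *)
Lemma sylvester_lower_bound U : posdiag U -> exists e c : R, [/\ 0 < e, 0 < c &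
  forall V W, `|V - U| <= e -> `|W - U| <= e ->
  forall X, `|X| <= c * `|V *m X + X *m W|].
Proof.
move=> /sylvester_inverse_exists [L [_ LK [c c0 bL]]].
exists (4 * (c + 1) * (d%:R + 1))^-1, (2 * (c + 1)); split.
- by rewrite invr_gt0 !mulr_gt0// ltr_wpDl.
- by rewrite mulr_gt0// ltr_wpDl.
set e := _^-1 => V W Ve We X.
have e0 : 0 <= e by rewrite invr_ge0 !mulr_ge0// addr_ge0.
have XE : X = L (V *m X + X *m W - ((V - U) *m X + X *m (W - U))).
  rewrite -[LHS]LK; congr (L _); rewrite mulmxBl mulmxBr.
  by rewrite addrACA -opprD opprB [RHS]addrC subrK.
have h1 : `|(V - U) *m X| <= d%:R * e * `|X|.
  by rewrite (le_trans (norm_mulmx _ _))// ler_wpM2r// ler_wpM2l.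
have h2 : `|X *m (W - U)| <= d%:R * e * `|X|.
  by rewrite (le_trans (norm_mulmx _ _))// mulrAC ler_wpM2r// ler_wpM2l.
have h3 : `|X| <= c * (`|V *m X + X *m W| + (d%:R * e * `|X| + d%:R * e * `|X|)).
  rewrite {1}XE (le_trans (bL _))// ler_wpM2l// (le_trans (ler_normB _ _))//.
  by rewrite lerD2l (le_trans (ler_normD _ _))// lerD.
have h4 : c * (d%:R * e) <= 4^-1.
  rewrite /e mulrA ler_pdivrMr ?mulr_gt0 ?ltr_wpDl//.
  have -> : 4^-1 * (4 * (c + 1) * (d%:R + 1)) = (c + 1) * (d%:R + 1) by field.
  by rewrite ler_pM// lerDl.
have X0 : 0 <= `|X| by []. have Y0 : 0 <= `|V *m X + X *m W| by [].
move: h3 h4 X0 Y0; move: `|X| `|V *m X + X *m W| (d%:R * e) => x y z h3 h4 x0 y0.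
have : c * z * x <= 4^-1 * x by rewrite ler_wpM2r.
by nra.
Qed.

(** One estimate [|Y| <= 2 (c + 1) |Y V|] gives both claims: [Y] is taken to be the kernel matrix of
    [V], then its inverse. *)
Lemma invmx_bound_near U : U \in unitmx -> exists e c : R, [/\ 0 < e, 0 < c &
  forall V, `|V - U| <= e -> V \in unitmx /\ `|invmx V| <= c].
Proof.
move=> uU; have [c c0 bU] := bounded_op_mulr (invmx U).
exists (2 * (c + 1) * (d%:R + 1))^-1, (2 * (c + 1) * (`|1%:M : 'M[R]_d| + 1)).
have p0 : 0 < (2 * (c + 1) * (d%:R + 1)) by rewrite !mulr_gt0// ltr_wpDl.
split; rewrite ?invr_gt0//; first by rewrite !mulr_gt0// ltr_wpDl.
set e := _^-1 => V Ve.
have e0 : 0 <= e by rewrite invr_ge0 ltW.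
have bnd Y : `|Y| <= 2 * (c + 1) * `|Y *m V|.
  have h1 : `|Y *m (V - U)| <= d%:R * e * `|Y|.
    by rewrite (le_trans (norm_mulmx _ _))// mulrAC ler_wpM2r// ler_wpM2l.
  have h2 : `|Y| <= c * (`|Y *m V| + d%:R * e * `|Y|).
    have {1}-> : Y = (Y *m V - Y *m (V - U)) *m invmx U.
      by rewrite mulmxBr opprB addrC subrK mulmxK.
    by rewrite (le_trans (bU _))// ler_wpM2l// (le_trans (ler_normB _ _))// lerD2l.
  have h4 : c * (d%:R * e) <= 2^-1.
    rewrite /e mulrA ler_pdivrMr//.
    have -> : 2^-1 * (2 * (c + 1) * (d%:R + 1)) = (c + 1) * (d%:R + 1) by field.
    by rewrite ler_pM// lerDl.
  have X0 : 0 <= `|Y| by []. have Y0 : 0 <= `|Y *m V| by [].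
  move: h2 h4 X0 Y0; move: `|Y| `|Y *m V| (d%:R * e) => x y z h3 h4 x0 y0.
  have : c * z * x <= 2^-1 * x by rewrite ler_wpM2r.
  by nra.
have uV : V \in unitmx.
  rewrite -row_free_unit -kermx_eq0 -normr_eq0 eq_le normr_ge0 andbT.
  by rewrite (le_trans (bnd _))// mulmx_ker normr0 mulr0.
split=> //; rewrite (le_trans (bnd _))// mulVmx// ler_wpM2l ?lerDl//.
by rewrite mulr_ge0// addr_ge0.
Qed.

(** Makes matrices a complete normed module, as Banach's fixed point theorem requires. *)
HB.instance Definition _ := Complete.on 'M[R]_d.

(** With [T = U + X] and [H = M - U U], the equation [T T = M] reads [U X + X U = H - X X], that is
    [X = L (H - X X)], a fixed point problem on a small ball. *)
Lemma sqrt_near_exists U : posdiag U -> forall e : R, 0 < e ->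
  exists2 r : R, 0 < r &
  forall M, `|M - U *m U| < r -> exists2 T, `|T - U| < e & T *m T = M.
Proof.
move=> /sylvester_inverse_exists [L [LK _ [c c0 bL]]] e e0.
pose k := 4 * (c + 1) * (d%:R + 1).
have k0 : 0 < k by rewrite !mulr_gt0// ltr_wpDl.
(* [r <= k^-1] gives [c d r <= 1/4], hence the contraction factor [1/2] for the two terms of
   [X X - Y Y]; [r <= e / 2] puts the solution within [e]. *)
pose r := Num.min (e / 2) k^-1.
have r0 : 0 < r by rewrite lt_min divr_gt0// invr_gt0 k0.
have cr : c * d%:R * r <= 4^-1.
  have h : c * d%:R * k^-1 <= 4^-1.
    rewrite ler_pdivrMr//.
    have -> : 4^-1 * k = (c + 1) * (d%:R + 1) by rewrite /k; field.
    by rewrite ler_pM// lerDl.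
  by rewrite (le_trans _ h)// ler_wpM2l ?mulr_ge0// ge_min lexx orbT.
have c1 : 0 < 2 * (c + 1) by rewrite mulr_gt0// ltr_wpDl.
(* For [H] of this size, [|L (H - X X)| <= r / 2 + r / 4] on the ball, which is therefore stable. *)
exists (r / (2 * (c + 1))); first by rewrite divr_gt0.
move=> M; have : exists H, H = M - U *m U by eexists.
move=> [H HE]; rewrite -HE => MU.
pose f X := L (H - X *m X); pose B : set 'M[R]_d := closed_ball_ Num.norm 0 r.
have BE X : B X <-> `|X| <= r by rewrite /B /closed_ball_ /= sub0r normrN.
have fB : {homo f : X / B X >-> B X}.
  move=> X /BE Xr; apply/BE; rewrite /f (le_trans (bL _))//.
  have h1 : `|X *m X| <= d%:R * r * r.
    rewrite (le_trans (norm_mulmx _ _))//.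
    by apply: ler_pM; rewrite ?mulr_ge0// ler_wpM2l.
  have h2 : `|H - X *m X| <= r / (2 * (c + 1)) + d%:R * r * r.
    by rewrite (le_trans (ler_normB _ _))// lerD// ltW.
  rewrite (le_trans (ler_wpM2l c0 h2))// mulrDr.
  have h3 : c * (r / (2 * (c + 1))) <= r / 2.
    rewrite mulrA ler_pdivrMr//; have -> : r / 2 * (2 * (c + 1)) = r * (c + 1) by field.
    by rewrite mulrC ler_wpM2l ?ltW// ltrDl.
  have h4 : c * (d%:R * r * r) <= r / 4.
    by rewrite !mulrA (mulrC r) ler_wpM2r// ltW.
  by move: h3 h4 r0; move: (c * _) (c * _) => x y; lra.
have ctr : is_contraction (mkfun_fun fB).
  have q0 : 0 <= 2^-1 :> R by [].
  exists (NngNum q0); split=> /=; first by lra.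
  move=> [X Y] [/BE /= Xr /BE /= Yr]; rewrite /f /= -linearB /=.
  have -> : H - X *m X - (H - Y *m Y) = - (X *m (X - Y) + (X - Y) *m Y).
    by rewrite mulmxBr mulmxBl addrA subrK !opprB [LHS]addrC addrA subrK.
  rewrite linearN normrN (le_trans (bL _))//.
  have h1 : `|X *m (X - Y)| <= d%:R * r * `|X - Y|.
    by rewrite (le_trans (norm_mulmx _ _))// ler_wpM2r// ler_wpM2l.
  have h2 : `|(X - Y) *m Y| <= d%:R * r * `|X - Y|.
    by rewrite (le_trans (norm_mulmx _ _))// mulrAC ler_wpM2r// ler_wpM2l.
  rewrite (le_trans (ler_wpM2l c0 (ler_normD _ _)))//.
  rewrite (le_trans (ler_wpM2l c0 (lerD h1 h2)))//.
  have : c * d%:R * r * `|X - Y| <= 4^-1 * `|X - Y| by rewrite ler_wpM2r.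
  by rewrite mulrDr !mulrA; move: `|X - Y| => x; lra.
have [] := banach_fixed_point ctr.
- exact: closed_closed_ball_.
- by exists 0; apply/BE; rewrite normr0 ltW.
move=> X /BE Xr XE; exists (U + X).
  rewrite addrC addKr (le_lt_trans Xr)// gt_min; apply/orP; left.
  by rewrite ltr_pdivrMr// ltr_pMr// ltr1n.
have := LK (H - X *m X); rewrite -[L _]/(f X) -[f X]/(mkfun_fun fB X) -XE => e1.
by rewrite mulmxDl !mulmxDr -addrA [X in _ + X]addrA e1 subrK HE addrC subrK.
Qed.

(* Bauer-Fike: compare the entries of largest modulus of an eigenvector. *)
Lemma eigenvalue_near (Q : 'M[R]_d) (l : 'rV[R]_d) : Q \in unitmx ->
  forall e : R, 0 < e -> exists2 r : R, 0 < r &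
  forall M, `|M - invmx Q *m diag_mx l *m Q| < r ->
  forall z : R[i], eigenvalue (complex_mx M) z -> exists i, `|z - (l 0 i)%:C| < e%:C.
Proof.
move=> uQ e e0.
have [c c0 bE] := bounded_op_comp (bounded_op_mulr (invmx Q)) (bounded_op_mull Q).
exists (e / (d%:R * c + 1)); first by rewrite divr_gt0// ltr_wpDl// mulr_ge0.
move=> M MU z /eigenvalueP [v vM v0].
pose E := Q *m (M - invmx Q *m diag_mx l *m Q) *m invmx Q.
have El : Q *m M *m invmx Q = diag_mx l + E.
  by rewrite /E mulmxBr mulmxBl !mulmxA mulmxV// mul1mx mulmxK// addrC subrK.
(* Column sums, since eigenvectors are rows acting from the left. *)
have sE i : \sum_j `|E j i| < e.
  have : \sum_j `|E j i| <= d%:R * c * (e / (d%:R * c + 1)).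
    rewrite -mulrA mulr_natl -[X in _ *+ X](card_ord d) -sumr_const ler_sum// => j _.
    rewrite (le_trans (entry_le_norm _ _ _))// (le_trans (bE _))//.
    by rewrite ler_wpM2l// ltW.
  move=> /le_lt_trans; apply; rewrite mulrA ltr_pdivrMr ?ltr_wpDl ?mulr_ge0//.
  by rewrite mulrC ltr_pM2l// ltrDl.
pose Qc := complex_mx Q; pose w := v *m map_mx (real_complex R) (invmx Q).
have QQ : map_mx (real_complex R) (invmx Q) *m Qc = 1%:M.
  by rewrite -map_mxM mulVmx// map_mx1.
have w0 : w != 0.
  by apply: contra v0 => /eqP e1; rewrite -[v]mulmx1 -QQ mulmxA -/w e1 mul0mx.
have wE : w *m complex_mx (diag_mx l + E) = z *: w.
  by rewrite -El /complex_mx !map_mxM !mulmxA -(mulmxA v) QQ mulmx1 vM scalemxAl.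
have [i0 wi0] : exists i0, w 0 i0 != 0.
  apply/existsP; apply: contraR w0; rewrite negb_exists => /forallP H.
  by apply/eqP/rowP => i; rewrite [RHS]mxE; apply/eqP; move: (H i); rewrite negbK.
(* Moduli live in [R[i]], whose order is partial; the maximum is taken over their real parts. *)
have [i imax] : exists i, forall j, complex.Re `|w 0 j| <= complex.Re `|w 0 i|.
  case: (@arg_maxP _ R _ i0 xpredT (fun i => complex.Re `|w 0 i|) isT) => i _ H.
  by exists i => j; exact: H.
have nE (x : R[i]) : `|x| = (complex.Re `|x|)%:C by rewrite normc_def.
have wmax j : `|w 0 j| <= `|w 0 i| by rewrite nE [leRHS]nE lecR; exact: imax.
have wi : 0 < `|w 0 i| by rewrite (lt_le_trans _ (wmax i0))// normr_gt0.
exists i; rewrite -(ltr_pM2r wi) -normrM.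
have -> : (z - (l 0 i)%:C) * w 0 i = \sum_j w 0 j * (E j i)%:C.
  have wl : (w *m complex_mx (diag_mx l)) 0 i = (l 0 i)%:C * w 0 i.
    rewrite mxE (bigD1 i)//= big1 => [|j ji]; rewrite !mxE.
      by rewrite eqxx mulr1n addr0 mulrC.
    by rewrite (negPf ji) mulr0.
  move/rowP/(_ i): wE; rewrite /complex_mx map_mxD mulmxDr mxE wl [RHS]mxE mulrBl => <-.
  by rewrite addrAC subrr add0r mxE; apply: eq_bigr => j _; congr (_ * _); rewrite [LHS]mxE.
apply: (le_lt_trans (ler_norm_sum _ _ _)).
apply: (@le_lt_trans _ _ (\sum_j `|w 0 i| * (`|E j i|)%:C)).
  apply: ler_sum => j _; rewrite normrM.
  have -> : `|(E j i)%:C| = (`|E j i|)%:C :> R[i].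
    by rewrite normc_def /= expr0n /= addr0 sqrtr_sqr.
  by rewrite ler_wpM2r// lecR.
by rewrite -mulr_sumr -rmorph_sum /= mulrC ltr_pM2r// ltcR.
Qed.

End Sylvester.

(** * Second order expansions *)

Section OrderOfVanishing.
Context {R : realType} {V : normedModType R}.

(** [f h = O(|h|^n)] at the origin; for [n = 0], boundedness near it. *)
Definition vanishes {W : normedModType R} (n : nat) (f : V -> W) :=
  exists2 C : R, 0 <= C & \forall h \near (0 : V), `|f h| <= C * `|h| ^+ n.

Lemma near_norm_le (e : R) : 0 < e -> \forall h \near (0 : V), `|h| <= e.
Proof.
move=> e0; apply/nbhs_norm0P; exists e => //= x /=; exact: ltW.
Qed.

Section Module.
Context {W : normedModType R}.
Implicit Types f g : V -> W.

Lemma near_vanishes n f g : (\forall h \near (0 : V), f h = g h) ->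
  vanishes n f -> vanishes n g.
Proof.
move=> fg [C C0 fC]; exists C => //.
by apply: filterS2 fg fC => h ->.
Qed.

Lemma eq_vanishes n f g : f =1 g -> vanishes n f -> vanishes n g.
Proof. by move=> fg; apply: near_vanishes; apply: nearW. Qed.

Lemma vanishesD n f g : vanishes n f -> vanishes n g ->
  vanishes n (fun h => f h + g h).
Proof.
move=> [C C0 fC] [D D0 gD]; exists (C + D); first exact: addr_ge0.
apply: filterS2 fC gD => h fh gh.
by rewrite (le_trans (ler_normD _ _))// mulrDl lerD.
Qed.

Lemma vanishesN n f : vanishes n f -> vanishes n (fun h => - f h).
Proof.
by move=> [C C0 fC]; exists C => //; apply: filterS fC => h; rewrite normrN.
Qed.

Lemma vanishesB n f g : vanishes n f -> vanishes n g ->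
  vanishes n (fun h => f h - g h).
Proof. by move=> vf vg; apply: vanishesD => //; exact: vanishesN. Qed.

Lemma vanishes_cst (x : W) : vanishes 0 (fun=> x).
Proof. by exists `|x| => //; apply: nearW => h; rewrite expr0 mulr1. Qed.

Lemma vanishes_weaken n f :
  vanishes n.+1 f -> vanishes n f.
Proof.
move=> [C C0 fC]; exists C => //; apply: filterS2 fC (near_norm_le ltr01) => h fh h1.
by rewrite (le_trans fh)// exprS ler_wpM2l// ler_piMl// exprn_ge0.
Qed.

Lemma all_vanishes (C : R) n f : 0 <= C -> (forall h, `|f h| <= C * `|h| ^+ n) ->
  vanishes n f.
Proof. by move=> C0 fC; exists C => //; apply: nearW. Qed.

End Module.

Lemma near_all (P : V -> Prop) (x : V) : (forall y, P y) -> \forall y \near x, P y.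
Proof. exact: nearW. Qed.

Lemma near_mono (P Q : V -> Prop) (x : V) : (forall y, P y -> Q y) ->
  (\forall y \near x, P y) -> \forall y \near x, Q y.
Proof. exact: filterS. Qed.

Lemma near_and (P Q : V -> Prop) (x : V) : (\forall y \near x, P y) ->
  (\forall y \near x, Q y) -> \forall y \near x, P y /\ Q y.
Proof. exact: filterI. Qed.

(** Differentiating at each point near [p] requires information on a whole neighbourhood of that
    point. *)
Lemma near_near_translate (P : V -> Prop) (x : V) : (\forall y \near x, P y) ->
  \forall y \near x, \forall h \near (0 : V), P (y + h).
Proof.
move=> H; have : \forall y \near x, \forall z \near y, P z by exact: nbhs_interior.
by apply: filterS => y /nbhs0P.
Qed.

Lemma vanishes_le {W W' : normedModType R} (c : R) n (f : V -> W) (g : V -> W') :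
  0 <= c -> (\forall h \near (0 : V), `|g h| <= c * `|f h|) ->
  vanishes n f -> vanishes n g.
Proof.
move=> c0 gf [C C0 fC]; exists (c * C); first exact: mulr_ge0.
apply: filterS2 gf fC => h gh fh.
by rewrite (le_trans gh)// -mulrA ler_wpM2l.
Qed.

Lemma vanishesM d n m (f g : V -> 'M[R]_d) :
  vanishes n f -> vanishes m g -> vanishes (n + m) (fun h => f h *m g h).
Proof.
move=> [C C0 fC] [D D0 gD]; exists (d%:R * C * D); first by rewrite !mulr_ge0.
apply: filterS2 fC gD => h fh gh.
rewrite (le_trans (norm_mulmx _ _))// exprD.
have -> : d%:R * C * D * (`|h| ^+ n * `|h| ^+ m) =
  d%:R * (C * `|h| ^+ n) * (D * `|h| ^+ m) by ring.
by rewrite ler_pM ?mulr_ge0// ler_wpM2l.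
Qed.

Lemma vanishes_tr d n (f : V -> 'M[R]_d) :
  vanishes n f -> vanishes n (fun h => \tr (f h) : R^o).
Proof.
by apply: (@vanishes_le _ _ d%:R) => //; apply: nearW => h; exact: norm_mxtrace.
Qed.

Lemma vanishes_differentiable (f : V -> R) (q : V) (D : {linear V -> R^o}) (c : R) :
  (forall k, `|D k| <= c * `|k|) ->
  vanishes 2 (fun h => f (q + h) - f q - D h : R^o) ->
  differentiable f q /\ 'd f q = D :> (V -> R).
Proof.
move=> Dc [C C0 fC].
have cD : continuous D.
  apply/linear_bounded_continuous/ex_bound; exists `|c|.
  apply: filterS (near_norm_le ltr01) => h h1.
  apply: (le_trans (Dc h)); rewrite (le_trans (ler_norm _))// normrM normr_id.
  by rewrite ler_piMr.
have e : f \o shift q = cst (f q) + D +o_ 0 id.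
  apply/eqaddoP => e e0; near=> h; rewrite /= !fctE /=.
  have -> : f (h + q) - (f q + D h) = f (q + h) - f q - D h 
    by rewrite opprD addrA [h + q]addrC.
  rewrite (@le_trans _ _ (C * `|h| ^+ 2))//; first by near: h.
  rewrite expr2 mulrA ler_wpM2r//.
  have h1 : `|h| <= e / (C + 1).
    by near: h; apply: near_norm_le; rewrite divr_gt0// ltr_wpDl.
  rewrite (le_trans (ler_wpM2l C0 h1))// mulrA ler_pdivrMr ?ltr_wpDl//.
  by rewrite mulrC ler_pM2l// lerDl.
have dD := diff_unique cD e; split=> //.
by apply/diff_locallyP; rewrite dD.
Unshelve. all: by end_near. Qed.

End OrderOfVanishing.

(** * Differentiating the trace of a square root of [A B] *)

Section TraceOfSquareRoot.
Context {R : realType} {d : nat}.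
Local Notation V := (gaussian_pair R d).
Implicit Types (q h k : V) (W X : 'M[R]_d).

Lemma norm_fst (V1 V2 : normedModType R) (x : V1 * V2) : `|x.1| <= `|x|.
Proof. by rewrite [leRHS]prod_normE le_max lexx. Qed.

Lemma norm_snd (V1 V2 : normedModType R) (x : V1 * V2) : `|x.2| <= `|x|.
Proof. by rewrite [leRHS]prod_normE le_max lexx orbT. Qed.

Lemma norm21 q : `|q.2.1| <= `|q|.
Proof. exact: le_trans (norm_fst q.2) (norm_snd q). Qed.
Lemma norm22 q : `|q.2.2| <= `|q|.
Proof. exact: le_trans (norm_snd q.2) (norm_snd q). Qed.
Lemma norm11 q : `|q.1.1| <= `|q|.
Proof. exact: le_trans (norm_fst q.1) (norm_fst q). Qed.
Lemma norm12 q : `|q.1.2| <= `|q|.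
Proof. exact: le_trans (norm_snd q.1) (norm_fst q). Qed.

Definition inner (x y : 'rV[R]_d) : R := \sum_i x 0 i * y 0 i.

Lemma norm_inner x y : `|inner x y| <= d%:R * `|x| * `|y|.
Proof.
rewrite (le_trans (ler_norm_sum _ _ _))//.
rewrite -mulrA mulr_natl -[X in _ *+ X](card_ord d) -sumr_const ler_sum// => i _.
by rewrite normrM ler_pM ?entry_le_norm.
Qed.

Definition mean_diff q : 'rV[R]_d := q.1.1 - q.1.2.

Lemma norm_mean_diff q : `|mean_diff q| <= 2 * `|q|.
Proof.
by rewrite (le_trans (ler_normB _ _))// mulr_natl mulr2n lerD ?norm11 ?norm12.
Qed.

Definition cov_prod q : 'M[R]_d := q.2.1 *m q.2.2.

(** The derivative of [cov_prod] at [q] along [h]. Being bilinear and symmetric, it is also the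
    constant second derivative, evaluated at [h] and [k] in the Hessian. *)
Definition dcov_prod q h : 'M[R]_d := h.2.1 *m q.2.2 + q.2.1 *m h.2.2.

Lemma norm_dcov_prod q h : `|dcov_prod q h| <= 2 * d%:R * `|q| * `|h|.
Proof.
rewrite (le_trans (ler_normD _ _))// -!mulrA mulr_natl mulr2n lerD//.
  rewrite (le_trans (norm_mulmx _ _))// -mulrA ler_wpM2l// [leRHS]mulrC.
  by rewrite ler_pM ?norm21 ?norm22.
rewrite (le_trans (norm_mulmx _ _))// -mulrA ler_wpM2l//.
by rewrite ler_pM ?norm21 ?norm22.
Qed.

Lemma cov_prodD q h : cov_prod (q + h) = cov_prod q + (dcov_prod q h + h.2.1 *m h.2.2).
Proof.
rewrite /cov_prod /dcov_prod /= mulmxDl !mulmxDr -!addrA; congr (_ + _).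
by rewrite addrCA.
Qed.

Lemma cov_prodB q h : cov_prod (q + h) - cov_prod q = dcov_prod q h + h.2.1 *m h.2.2.
Proof. by rewrite cov_prodD [LHS]addrC addKr. Qed.

Lemma dcov_prodD q h k : dcov_prod (q + h) k = dcov_prod q k + dcov_prod h k.
Proof. by rewrite /dcov_prod /= mulmxDl !mulmxDr addrACA. Qed.

Lemma dcov_prodC h k : dcov_prod h k = dcov_prod k h.
Proof. by rewrite /dcov_prod addrC. Qed.

Lemma dcov_prodP q (a : R) h k :
  dcov_prod q (a *: h + k) = a *: dcov_prod q h + dcov_prod q k.
Proof.
rewrite /dcov_prod /= mulmxDl mulmxDr -scalemxAl -scalemxAr scalerDr.
by rewrite addrACA.
Qed.

Lemma sqr_distE q : sqr_dist q.1.1 q.1.2 = inner (mean_diff q) (mean_diff q).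
Proof. by apply: eq_bigr => i _; rewrite !mxE expr2. Qed.

Lemma mean_diffP (a : R) h k : mean_diff (a *: h + k) = a *: mean_diff h + mean_diff k.
Proof. by rewrite /mean_diff /= scalerBr opprD addrACA. Qed.

Lemma innerC x y : inner x y = inner y x.
Proof. by apply: eq_bigr => i _; rewrite mulrC. Qed.

Lemma innerP x (a : R) y z : inner x (a *: y + z) = a * inner x y + inner x z.
Proof.
rewrite /inner mulr_sumr -big_split; apply: eq_bigr => i _ /=.
by rewrite !mxE; ring.
Qed.

Lemma sqr_distD q h : sqr_dist (q + h).1.1 (q + h).1.2 =
  sqr_dist q.1.1 q.1.2 + 2 * inner (mean_diff q) (mean_diff h) +
  inner (mean_diff h) (mean_diff h).
Proof.
rewrite !sqr_distE; have -> : mean_diff (q + h) = 1 *: mean_diff q + mean_diff h.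
  by rewrite -mean_diffP scale1r.
rewrite innerP (innerC _ (mean_diff q)) (innerC _ (mean_diff h)) !innerP.
by rewrite (innerC (mean_diff h) (mean_diff q)); ring.
Qed.

(* [W] stands for [U^-1] with [U U = A B]: differentiating gives
   [2 tr (dU) = tr (U^-1 d(A B))]. *)
Definition gradient W q k : R := 2 * inner (mean_diff q) (mean_diff k) +
  \tr k.2.1 + \tr k.2.2 - \tr (W *m dcov_prod q k).

Lemma gradient_linear W q : linear (gradient W q : V -> R^o).
Proof.
move=> a h k; rewrite /gradient dcov_prodP mean_diffP innerP /= !mxtraceD !mxtraceZ.
by rewrite mulmxDr -scalemxAr mxtraceD mxtraceZ /GRing.scale /=; ring.
Qed.

Lemma norm_gradient W q : exists c : R, forall k, `|gradient W q k| <= c * `|k|.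
Proof.
exists (2 * (d%:R * `|mean_diff q| * 2) + d%:R + d%:R +
  d%:R * (d%:R * `|W| * (2 * d%:R * `|q|))) => k.
have a1 : `|2 * inner (mean_diff q) (mean_diff k)| <= 2 * (d%:R * `|mean_diff q| * 2) * `|k|.
  rewrite normrM ger0_norm// -[leRHS]mulrA ler_wpM2l// (le_trans (norm_inner _ _))//.
  by rewrite -[leRHS]mulrA ler_wpM2l ?mulr_ge0// norm_mean_diff.
have a2 : `|\tr k.2.1| <= d%:R * `|k|.
  by rewrite (le_trans (norm_mxtrace _))// ler_wpM2l// norm21.
have a3 : `|\tr k.2.2| <= d%:R * `|k|.
  by rewrite (le_trans (norm_mxtrace _))// ler_wpM2l// norm22.
have a4 : `|\tr (W *m dcov_prod q k)| <= d%:R * (d%:R * `|W| * (2 * d%:R * `|q|)) * `|k|.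
  rewrite (le_trans (norm_mxtrace _))// -[leRHS]mulrA ler_wpM2l//.
  rewrite (le_trans (norm_mulmx _ _))// -[leRHS]mulrA ler_wpM2l ?mulr_ge0//.
  exact: norm_dcov_prod.
rewrite [leRHS]mulrDl [X in _ <= X + _]mulrDl [X in _ <= X + _ + _]mulrDl.
apply: (le_trans (ler_normB _ _)); apply: lerD => //.
apply: (le_trans (ler_normD _ _)); apply: lerD => //.
by apply: (le_trans (ler_normD _ _)); apply: lerD.
Qed.

Lemma vanishes21 : vanishes 1 (fun h => h.2.1).
Proof. by apply: (@all_vanishes _ _ _ 1) => // h; rewrite mul1r norm21. Qed.
Lemma vanishes22 : vanishes 1 (fun h => h.2.2).
Proof. by apply: (@all_vanishes _ _ _ 1) => // h; rewrite mul1r norm22. Qed.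

Lemma vanishes_dcov_prod q : vanishes 1 (dcov_prod q).
Proof.
apply: (@all_vanishes _ _ _ (2 * d%:R * `|q|)); first by rewrite !mulr_ge0.
by move=> h; exact: norm_dcov_prod.
Qed.

Lemma vanishes_cov_prod q : vanishes 1 (fun h => cov_prod (q + h) - cov_prod q).
Proof.
apply: (@eq_vanishes _ _ _ _ (fun h => dcov_prod q h + h.2.1 *m h.2.2)).
  by move=> h; rewrite cov_prodB.
apply: vanishesD; first exact: vanishes_dcov_prod.
apply: vanishes_weaken; exact: (vanishesM vanishes21 vanishes22).
Qed.

(* [L] is the derivative of the square root at [A B], the inverse of
   [X |-> U X + X U], so that [- W (L _) W] is the derivative of [W = U^-1]. *)
Definition hessian (L : 'M[R]_d -> 'M[R]_d) W q h k : R :=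
  2 * inner (mean_diff h) (mean_diff k) +
  \tr (W *m L (dcov_prod q h) *m W *m dcov_prod q k) - \tr (W *m dcov_prod h k).

Lemma hessian_sym (U0 : 'M[R]_d) (L : {linear 'M[R]_d -> 'M[R]_d}) q h k :
  U0 \in unitmx -> sylvester_inverse U0 L ->
  hessian L (invmx U0) q h k = hessian L (invmx U0) q k h.
Proof.
move=> uU [LK _ _]; rewrite /hessian innerC (dcov_prodC h k).
congr (_ + _ - _); set W := invmx U0.
(* Both increments are written as [U0 X + X U0] and [U0 Y + Y U0]; the middle term then becomes
   [tr (W X Y) + tr (W Y X)]. *)
move: (LK (dcov_prod q h)) (LK (dcov_prod q k)).
move: (L (dcov_prod q h)) (L (dcov_prod q k)) => X Y <- <-.
have trE (X' Y' : 'M[R]_d) : \tr (W *m X' *m W *m (U0 *m Y' + Y' *m U0)) =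
    \tr (W *m X' *m Y') + \tr (W *m Y' *m X').
  rewrite mulmxDr mxtraceD mulmxA mulmxKV// mulmxA [X in _ + X]mxtrace_mulC.
  rewrite !mulmxA mulmxV// mul1mx; congr (_ + _).
  by rewrite -mulmxA mxtrace_mulC.
by rewrite !trE addrC.
Qed.

Lemma mxtrace_mulP (A : 'M[R]_d) (a : R) X Y :
  \tr (A *m (a *: X + Y)) = a * \tr (A *m X) + \tr (A *m Y).
Proof. by rewrite mulmxDr -scalemxAr mxtraceD mxtraceZ. Qed.

Lemma hessian_linear (L : {linear 'M[R]_d -> 'M[R]_d}) W q h (a : R) k k' :
  hessian L W q h (a *: k + k') = a * hessian L W q h k + hessian L W q h k'.
Proof.
by rewrite /hessian !dcov_prodP mean_diffP innerP !mxtrace_mulP; ring.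
Qed.

Lemma norm_mxtrace_mul (X Y : 'M[R]_d) : `|\tr (X *m Y)| <= d%:R * d%:R * `|X| * `|Y|.
Proof.
rewrite (le_trans (norm_mxtrace _))// -!mulrA ler_wpM2l// mulrA; exact: norm_mulmx.
Qed.

Lemma norm_hessian (L : {linear 'M[R]_d -> 'M[R]_d}) W q : bounded_op L ->
  exists c : R, forall h k, `|hessian L W q h k| <= c * `|h| * `|k|.
Proof.
move=> bL.
have [b b0 bW] := bounded_op_comp (bounded_op_mulr W) (bounded_op_comp (bounded_op_mull W) bL).
exists (2 * (d%:R * 2 * 2) + d%:R * d%:R * (b * (2 * d%:R * `|q|)) * (2 * d%:R * `|q|) +
  d%:R * d%:R * `|W| * (2 * d%:R)) => h k.
have a1 : `|2 * inner (mean_diff h) (mean_diff k)| <= 2 * (d%:R * 2 * 2) * `|h| * `|k|.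
  rewrite normrM ger0_norm// -!mulrA ler_wpM2l// (le_trans (norm_inner _ _))//.
  have -> : d%:R * (2 * (2 * (`|h| * `|k|))) = d%:R * (2 * `|h|) * (2 * `|k|) by ring.
  by apply: ler_pM; rewrite ?mulr_ge0 ?norm_mean_diff// ler_wpM2l// norm_mean_diff.
have a2 : `|\tr (W *m L (dcov_prod q h) *m W *m dcov_prod q k)| <=
    d%:R * d%:R * (b * (2 * d%:R * `|q|)) * (2 * d%:R * `|q|) * `|h| * `|k|.
  rewrite (le_trans (norm_mxtrace_mul _ _))//.
  have -> : d%:R * d%:R * (b * (2 * d%:R * `|q|)) * (2 * d%:R * `|q|) * `|h| * `|k| =
    d%:R * d%:R * (b * (2 * d%:R * `|q| * `|h|)) * (2 * d%:R * `|q| * `|k|) by ring.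
  apply: ler_pM; rewrite ?mulr_ge0 ?norm_dcov_prod// ler_wpM2l ?mulr_ge0//.
  by rewrite (le_trans (bW _))// ler_wpM2l// norm_dcov_prod.
have a3 : `|\tr (W *m dcov_prod h k)| <= d%:R * d%:R * `|W| * (2 * d%:R) * `|h| * `|k|.
  rewrite (le_trans (norm_mxtrace_mul _ _))//.
  have -> : d%:R * d%:R * `|W| * (2 * d%:R) * `|h| * `|k| =
    d%:R * d%:R * `|W| * (2 * d%:R * `|h| * `|k|) by ring.
  by rewrite ler_wpM2l ?mulr_ge0// norm_dcov_prod.
rewrite /hessian; apply: (le_trans (ler_normB _ _)).
apply: (le_trans (lerD (le_trans (ler_normD _ _) (lerD a1 a2)) a3)).
by rewrite -!mulrDl.
Qed.

Section SecondDerivative.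
Variables (F : V -> R) (U : V -> 'M[R]_d) (p : V) (U0 : 'M[R]_d).
Hypothesis U0pos : posdiag U0.
Hypothesis U0sq : U0 *m U0 = cov_prod p.
Hypothesis Unear : forall e : R, 0 < e -> \forall q \near p,
  [/\ `|U q - U0| <= e, U q *m U q = cov_prod q &
      F q = sqr_dist q.1.1 q.1.2 + \tr q.2.1 + \tr q.2.2 - 2 * \tr (U q)].

(** [e] will be a fixed radius around [U0] in which the Sylvester and inverse bounds hold; [good]
    collects what is then used of a point near [p]. *)
Let good (e : R) q := [/\ `|U q - U0| <= e, U q *m U q = cov_prod q &
  F q = sqr_dist q.1.1 q.1.2 + \tr q.2.1 + \tr q.2.2 - 2 * \tr (U q)].

Lemma near_posdiag_sqrt : exists e c : R, [/\ 0 < c,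
  \forall q \near p, good e q,
  forall X Y : 'M[R]_d, `|X - U0| <= e -> `|Y - U0| <= e ->
    forall Z, `|Z| <= c * `|X *m Z + Z *m Y| &
  forall X : 'M[R]_d, `|X - U0| <= e -> X \in unitmx /\ `|invmx X| <= c].
Proof.
have [e1 [c1 [e10 c10 H1]]] := sylvester_lower_bound U0pos.
have [e2 [c2 [e20 c20 H2]]] := invmx_bound_near (posdiag_unit U0pos).
exists (Num.min e1 e2), (c1 + c2); split.
- exact: addr_gt0.
- by apply: Unear; rewrite lt_min e10.
- move=> X Y; rewrite !le_min => /andP[X1 _] /andP[Y1 _] Z.
  by rewrite (le_trans (H1 _ _ X1 Y1 Z))// ler_wpM2r// lerDl ltW.
- move=> X; rewrite le_min => /andP[_ /H2 [uX Xc]]; split=> //.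
  by rewrite (le_trans Xc)// lerDr ltW.
Qed.

Variables (e c : R) (c0 : 0 < c) (goodp : \forall q \near p, good e q).
Hypothesis sylv : forall X Y : 'M[R]_d, `|X - U0| <= e -> `|Y - U0| <= e ->
    forall Z, `|Z| <= c * `|X *m Z + Z *m Y|.
Hypothesis invU : forall X : 'M[R]_d, `|X - U0| <= e ->
  X \in unitmx /\ `|invmx X| <= c.

(** The noncommutative [V V - W W = V (V - W) + (V - W) W]: an exact Sylvester equation for the
    increment, with different coefficients on the two sides. *)
Lemma sylvester_increment q h : good e q -> good e (q + h) ->
  U (q + h) *m (U (q + h) - U q) + (U (q + h) - U q) *m U q =
  cov_prod (q + h) - cov_prod q.
Proof.
by move=> [_ e1 _] [_ e2 _]; rewrite mulmxBr mulmxBl e1 e2 addrA subrK.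
Qed.

(** The Sylvester bound turns the [O(|h|)] increment of [A B] into one of [U]. Continuity of [U] at
    [q] is a result here: being [good] only keeps [U] within [e] of [U0]. *)
Lemma vanishes_increment q : good e q -> (\forall h \near (0 : V), good e (q + h)) ->
  vanishes 1 (fun h => U (q + h) - U q).
Proof.
move=> gq gh; have := vanishes_cov_prod q.
apply: (@vanishes_le _ _ _ _ c); first exact: ltW.
apply: near_mono gh => h gqh; rewrite -(sylvester_increment gq gqh).
by apply: sylv; [have [] := gqh|have [] := gq].
Qed.

(** After multiplication by the inverse of [U q], the terms [U X] and [X U] both have trace [tr X],
    by cyclicity. The formula is exact, and its last term is quadratic in [X]. *)
Lemma mxtrace_increment q h X : good e q -> good e (q + h) ->
  X = U (q + h) - U q ->
  2 * \tr X = \tr (invmx (U q) *m (cov_prod (q + h) - cov_prod q)) -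
              \tr (invmx (U q) *m (X *m X)).
Proof.
move=> gq gh XE; rewrite -(sylvester_increment gq gh) -XE.
have [Uq _ _] := gq; have [uU _] := invU Uq.
have -> : U (q + h) = U q + X by rewrite XE [RHS]addrC subrK.
have e1 : \tr (invmx (U q) *m (X *m U q)) = \tr X.
  by rewrite mulmxA mxtrace_mulC mulmxA mulmxV// mul1mx.
by rewrite mulmxDl !mulmxDr mulKmx// !mxtraceD e1; ring.
Qed.

Lemma differentiable_near q : good e q -> (\forall h \near (0 : V), good e (q + h)) ->
  differentiable F q /\ 'd F q = gradient (invmx (U q)) q :> (V -> R).
Proof.
move=> gq gh; set W := invmx (U q).
pose D : {linear V -> R^o} := HB.pack (gradient W q : V -> R^o)
  (GRing.isLinear.Build _ _ _ _ (gradient W q : V -> R^o) (gradient_linear W q)).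
have [cD DcD] := norm_gradient W q.
apply: (@vanishes_differentiable _ _ _ _ D cD DcD).
pose X h := U (q + h) - U q.
(* The whole remainder of first order: the quadratic parts of the squared distance and of [A B], and
   the quadratic term of [mxtrace_increment]. *)
apply: (@near_vanishes _ _ _ _ (fun h => inner (mean_diff h) (mean_diff h) -
   \tr (W *m (h.2.1 *m h.2.2)) + \tr (W *m (X h *m X h)) : R^o)).
  apply: near_mono gh => h gqh; have := mxtrace_increment gq gqh (erefl (X h)).
  rewrite -/W cov_prodB mulmxDr mxtraceD.
  have -> : \tr (X h) = \tr (U (q + h)) - \tr (U q) by rewrite /X linearB.
  have [_ _ ->] := gq; have [_ _ ->] := gqh.
  have -> : D h = gradient W q h by [].
  rewrite sqr_distD /gradient /= !mxtraceD.
  by lra.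
have vX : vanishes 1 X by exact: vanishes_increment.
apply: vanishesD; first apply: vanishesB.
- apply: (@all_vanishes _ _ _ (d%:R * 2 * 2)) => [|h]; first by rewrite !mulr_ge0.
  apply: (le_trans (norm_inner _ _)).
  have -> : d%:R * 2 * 2 * `|h| ^+ 2 = d%:R * (2 * `|h|) * (2 * `|h|) by ring.
  by apply: ler_pM; rewrite ?mulr_ge0 ?norm_mean_diff// ler_wpM2l// norm_mean_diff.
- apply: vanishes_tr; rewrite -[2%N]/(0 + (1 + 1))%N.
  apply: vanishesM; first exact: vanishes_cst.
  by apply: vanishesM; [exact: vanishes21|exact: vanishes22].
- apply: vanishes_tr; rewrite -[2%N]/(0 + (1 + 1))%N.
  apply: vanishesM; first exact: vanishes_cst.
  exact: vanishesM.
Qed.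

(** Two square roots of one matrix in the ball of radius [e] solve a Sylvester equation with
    right-hand side 0, so the lower bound makes them equal. *)
Lemma posdiag_sqrt_at : U p = U0.
Proof.
have [Up Usq _] : good e p by exact: nbhs_singleton goodp.
have e0 : 0 <= e by exact: le_trans Up.
apply/eqP; rewrite -subr_eq0 -normr_le0.
rewrite (le_trans (sylv Up (_ : `|U0 - U0| <= e) _))//; first by rewrite subrr normr0.
by rewrite mulmxBr mulmxBl Usq U0sq addrA subrK subrr normr0 mulr0.
Qed.

Lemma hessian_second_derivative (L : {linear 'M[R]_d -> 'M[R]_d}) :
  sylvester_inverse U0 L ->
  (\forall q \near p, differentiable F q) /\
  is_second_derivative F p (hessian L (invmx U0) p).
Proof.
move=> sL; have [LK KL bL] := sL; have uU := posdiag_unit U0pos.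
have gnn := near_near_translate goodp.
have dF : \forall q \near p, differentiable F q /\
    'd F q = gradient (invmx (U q)) q :> (V -> R).
  by apply: near_mono (near_and goodp gnn) => q [gq gqh]; exact: differentiable_near.
split; first by apply: near_mono dF => q [].
set W := invmx U0; split.
- have lin2 := hessian_linear L W p.
  split=> [k a h h'|h a k k'] /=; last exact: lin2.
  by rewrite !(@hessian_sym U0 L p _ k uU sL); exact: lin2.
- exact: norm_hessian.
have gp : good e p by exact: nbhs_singleton goodp.
have gh : \forall h \near (0 : V), good e (p + h) by exact: nbhs_singleton gnn.
have dFp := nbhs_singleton dF.
have dFh : \forall h \near (0 : V), 'd F (p + h) = gradient (invmx (U (p + h))) (p + h) :> (V -> R).
  by apply: near_mono (nbhs_singleton (near_near_translate dF)) => h [].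
have Up := posdiag_sqrt_at.
pose X h := U (p + h) - U0; pose Wd h := invmx (U (p + h)) - W.
have vX : vanishes 1 X.
  by rewrite /X -{1}Up; exact: vanishes_increment.
have vW' : vanishes 0 (fun h => invmx (U (p + h))).
  exists c; first exact: ltW.
  apply: near_mono gh => h [/invU [_ ic] _ _].
  by rewrite expr0 mulr1.
have vWd : vanishes 1 Wd.
  apply: (@near_vanishes _ _ _ _ (fun h => - (invmx (U (p + h)) *m X h *m W))).
    apply: near_mono gh => h [/invU [uh _] _ _].
    by rewrite /Wd /X mulmxBr mulVmx// mulmxBl mul1mx mulmxK// opprB.
  apply: vanishesN; rewrite -[1%N]/(0 + 1 + 0)%N.
  by apply: vanishesM; [exact: vanishesM|exact: vanishes_cst].
(* The expansion of the square root: [L] applied to [U0 X + X U0 = dcov_prod p h + (h.2.1 *m h.2.2 -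
   X X)] leaves a quadratic error. *)
pose XL h := X h - L (dcov_prod p h).
have vXL : vanishes 2 XL.
  apply: (@near_vanishes _ _ _ _ (fun h => L (h.2.1 *m h.2.2 - X h *m X h))).
    apply: near_mono gh => h gph; have := sylvester_increment gp gph.
    rewrite Up cov_prodB -/(X h) => eX.
    have e1 : U0 *m X h + X h *m U0 = dcov_prod p h + (h.2.1 *m h.2.2 - X h *m X h).
      rewrite addrA -eX; have -> : U (p + h) = U0 + X h by rewrite /X [RHS]addrC subrK.
      by move: (X h) => Y; rewrite mulmxDl [Y' in _ = Y' - _]addrAC addrK.
    by apply: (canRL (addrK _)); rewrite addrC -linearD -e1 KL.
  have [b b0 bb] := bL; apply: (@vanishes_le _ _ _ _ b) => //.
    by apply: near_all => h; exact: bb.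
  apply: vanishesB; first exact: (vanishesM vanishes21 vanishes22).
  exact: (vanishesM vX vX).
(* The error in the derivative of the inverse. In [Wd = - (W + Wd) X W], the term [Wd X W] is of
   second order and [X] is [L (dcov_prod p h)] up to [XL]. *)
pose E1 h := Wd h + W *m L (dcov_prod p h) *m W.
have vE1 : vanishes 2 E1.
  apply: (@near_vanishes _ _ _ _ (fun h => - (Wd h *m X h *m W) - W *m XL h *m W)).
    apply: near_mono gh => h [/invU [uh _] _ _].
    have e1 : Wd h = - (invmx (U (p + h)) *m X h *m W).
      by rewrite /Wd /X mulmxBr mulVmx// mulmxBl mul1mx mulmxK// opprB.
    have eW : Wd h + W = invmx (U (p + h)) by rewrite /Wd subrK.
    have alg (a x l w : 'M[R]_d) : - (a *m x *m w) - w *m (x - l) *m w =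
        w *m l *m w - (a + w) *m x *m w.
      by rewrite mulmxBr mulmxBl opprB addrCA -opprD -!mulmxDl.
    by rewrite /E1 /XL alg eW -e1 addrC.
  apply: vanishesB; first apply: vanishesN.
    rewrite -[2%N]/(1 + 1 + 0)%N.
    by apply: vanishesM; [exact: vanishesM|exact: vanishes_cst].
  rewrite -[2%N]/(0 + 2 + 0)%N; apply: vanishesM; last exact: vanishes_cst.
  by apply: vanishesM; first exact: vanishes_cst.
have [C1 C10 H1] := vE1; have [C2 C20 H2] := vWd.
(* The summands bound the traces of [E1 h *m dcov_prod p k] and of [Wd h *m dcov_prod h k], both by
   multiples of [|h|^2 |k|]; these two traces are all that remains of the difference quotient. *)
pose K := d%:R * d%:R * C1 * (2 * d%:R * `|p|) + d%:R * d%:R * C2 * (2 * d%:R).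
have K0 : 0 <= K by rewrite addr_ge0// !mulr_ge0.
move=> eps eps0.
have eK : 0 < eps / (K + 1) by rewrite divr_gt0// ltr_wpDl.
apply: near_mono (near_and dFh (near_and (near_norm_le eK) (near_and H1 H2))).
move=> h [dh [hK [h1 h2]]] k.
have -> : 'd F (p + h) k - 'd F p k - hessian L W p h k =
    gradient (invmx (U (p + h))) (p + h) k - gradient W p k - hessian L W p h k.
  congr (_ - _ - _); first exact: (congr1 (fun D : V -> R => D k) dh).
  by rewrite /W -Up; exact: (congr1 (fun D : V -> R => D k) dFp.2).
have -> : gradient (invmx (U (p + h))) (p + h) k - gradient W p k - hessian L W p h k =
    - (\tr (E1 h *m dcov_prod p k) + \tr (Wd h *m dcov_prod h k)).
  rewrite /gradient /hessian /E1 /Wd dcov_prodD.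
  move: (dcov_prod p k) (dcov_prod h k) (L _) (invmx _) => P Q Y W'.
  rewrite !(mulmxDl, mulmxDr, mulNmx) !mxtraceD.
  rewrite !(linearN (@mxtrace R d)) /=.
  have -> : mean_diff (p + h) = 1 *: mean_diff p + mean_diff h.
    by rewrite -mean_diffP scale1r.
  by rewrite innerC innerP !(innerC (mean_diff k)); ring.
rewrite normrN; apply: (@le_trans _ _ (K * `|h| ^+ 2 * `|k|)).
  rewrite (le_trans (ler_normD _ _))// mulrDl mulrDl lerD//.
    rewrite (le_trans (norm_mxtrace_mul _ _))//.
    have -> : d%:R * d%:R * C1 * (2 * d%:R * `|p|) * `|h| ^+ 2 * `|k| =
      d%:R * d%:R * (C1 * `|h| ^+ 2) * (2 * d%:R * `|p| * `|k|) by ring.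
    by apply: ler_pM; rewrite ?mulr_ge0 ?norm_dcov_prod// ler_wpM2l.
  rewrite (le_trans (norm_mxtrace_mul _ _))//.
  have -> : d%:R * d%:R * C2 * (2 * d%:R) * `|h| ^+ 2 * `|k| =
    d%:R * d%:R * (C2 * `|h| ^+ 1) * (2 * d%:R * `|h| * `|k|) by ring.
  by apply: ler_pM; rewrite ?mulr_ge0 ?norm_dcov_prod// ler_wpM2l.
rewrite ler_wpM2r// expr2 mulrA ler_wpM2r//.
rewrite (le_trans (ler_wpM2l K0 hK))// mulrA ler_pdivrMr ?ltr_wpDl//.
by rewrite mulrC ler_pM2l// lerDl.
Qed.

End SecondDerivative.
End TraceOfSquareRoot.

(** * Uniqueness of the second derivative, and polarization *)

Section UniqueSecondDerivative.
Context {R : realType} {V : normedModType R}.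
Implicit Types (f : V -> R) (p : V) (B : V -> V -> R).

Lemma biscalarDl B h h' k : biscalar B -> B (h + h') k = B h k + B h' k.
Proof. by move=> [Bl _]; rewrite -[h in LHS]scale1r Bl /= mul1r. Qed.

Lemma biscalarDr B h k k' : biscalar B -> B h (k + k') = B h k + B h k'.
Proof. by move=> [_ Br]; rewrite -[k in LHS]scale1r Br /= mul1r. Qed.

Lemma biscalarZl B a h k : biscalar B -> B (a *: h) k = a * B h k.
Proof.
move=> bB; have B0 : B 0 k = 0.
  by apply: (addrI (B 0 k)); rewrite -biscalarDl// !addr0.
by move: bB => [Bl _]; rewrite -[a *: h]addr0 Bl /= B0 addr0.
Qed.

(** [B - B'] is homogeneous in [h] and at the same time [o(|h|)], as is seen by scaling [h] into the
    neighbourhood. This identifies the witness chosen by [D2] with the explicit Hessian. *)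
Lemma second_derivative_unique f p B B' :
  is_second_derivative f p B -> is_second_derivative f p B' -> B = B'.
Proof.
move=> [bB _ dB] [bB' _ dB']; apply/funext => h; apply/funext => k.
apply/eqP; rewrite -subr_eq0 -normr_le0 leNgt; apply/negP.
set D := `|_| => D0; pose M := `|h| * `|k|.
have M0 : 0 <= M by rewrite mulr_ge0.
(* Each of the two approximations may err by this factor times [M], and twice that is less than
   [D]. *)
have e0 : 0 < D / (2 * M + 1) by rewrite divr_gt0// ltr_wpDl// mulr_ge0.
have /nbhs_norm0P [r /= r0 rP] : \forall x \near (0 : V),
    `|B x k - B' x k| <= (D / (2 * M + 1)) * (2 * (`|x| * `|k|)).
  apply: filterS2 (dB _ e0) (dB' _ e0) => x h1 h2.
  have -> : B x k - B' x k = ('d f (p + x) k - 'd f p k - B' x k) -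
      ('d f (p + x) k - 'd f p k - B x k) by ring.
  rewrite (le_trans (ler_normB _ _))//.
  have -> : D / (2 * M + 1) * (2 * (`|x| * `|k|)) =
    D / (2 * M + 1) * `|x| * `|k| + D / (2 * M + 1) * `|x| * `|k| by ring.
  by apply: lerD; [exact: h2|exact: h1].
pose t := r / (2 * (`|h| + 1)).
have h1 : 0 < 2 * (`|h| + 1) by rewrite mulr_gt0// ltr_wpDl.
have t0 : 0 < t by rewrite divr_gt0.
have th : `|t *: h| < r.
  rewrite normrZ gtr0_norm// /t mulrAC ltr_pdivrMr// ltr_pM2l//.
  by rewrite mulrDr mulr1; have : 0 <= `|h| by []; lra.
clearbody t; have := rP _ th.
rewrite !biscalarZl// -mulrBr normrM normrZ (gtr0_norm t0) -/D.
have -> : D / (2 * M + 1) * (2 * (t * `|h| * `|k|)) = t * (D / (2 * M + 1) * (2 * M)).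
  by rewrite /M; ring.
rewrite ler_pM2l// => h2.
have : D / (2 * M + 1) * (2 * M) < D.
  rewrite mulrAC ltr_pdivrMr; last by rewrite ltr_wpDl// mulr_ge0.
  by rewrite ltr_pM2l// ltrDl.
by rewrite ltNge h2.
Qed.

Lemma D2E f p B : is_second_derivative f p B -> D2 f p = B.
Proof.
move=> dB; refine (second_derivative_unique _ dB).
by apply: (@getPex _ (is_second_derivative f p)); exists B.
Qed.

Lemma polarization B B' : biscalar B -> biscalar B' ->
  (forall h k, B h k = B k h) -> (forall h k, B' h k = B' k h) ->
  (forall h, B h h = B' h h) -> B = B'.
Proof.
move=> bB bB' sB sB' BB; apply/funext => h; apply/funext => k.
have := BB (h + k); rewrite !biscalarDl// !biscalarDr// !BB (sB k) (sB' k).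
by lra.
Qed.

End UniqueSecondDerivative.

(** * Circular contours *)

Section Circle.
Context {R : realType}.
Implicit Types (t s r : R).

Local Notation tau := (2 * pi : R).

(** A family closed under differentiation that contains both coordinates of a circle, so smoothness
    is an induction on the order. *)
Definition trig (a b c : R) (t : R) : R := a + b * cos (tau * t) + c * sin (tau * t).

Lemma is_derive_trig a b c t :
  is_derive t 1 (trig a b c) (trig 0 (tau * c) (- (tau * b)) t).
Proof.
have dm : is_derive t 1 (fun s : R => tau * s) tau.
  apply: (is_derive_eq (is_derive_mulf (is_derive_cst tau t 1) (is_derive_id t 1))).
  by rewrite /cst; ring.
have dc := @is_derive1_comp _ _ (fun s : R => tau * s) _ _ _ (is_derive_cos (tau * t)) dm.
have ds := @is_derive1_comp _ _ (fun s : R => tau * s) _ _ _ (is_derive_sin (tau * t)) dm.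
apply: (is_derive_eq (is_derive_addf (is_derive_addf (is_derive_cst a t 1)
  (is_derive_mulf (is_derive_cst b t 1) dc)) (is_derive_mulf (is_derive_cst c t 1) ds))).
by rewrite /trig /cst /=; ring.
Qed.

Lemma derive1_trig a b c : derive1 (trig a b c) = trig 0 (tau * c) (- (tau * b)).
Proof.
by apply/funext => t; rewrite derive1E; have [_ ->] := is_derive_trig a b c t.
Qed.

Lemma derivable_derive1n_trig n a b c t : derivable (derive1n n (trig a b c)) t 1.
Proof.
elim: n a b c => [|n IH] a b c; first by have [] := is_derive_trig a b c t.
by rewrite derive1Sn derive1_trig.
Qed.

Lemma cos_eq1 (x : R) : - tau < x < tau -> cos x = 1 -> x = 0.
Proof.
move=> xt cx; have x2 : x = (x / 2) *+ 2 by rewrite -mulr_natr divfK.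
have s0 : sin (x / 2) = 0.
  apply/eqP; rewrite -sqrf_eq0; apply/eqP.
  move: cx; rewrite {1}x2 cos_mulr2n; have := cos2Dsin2 (x / 2).
  by rewrite -mulr_natl; lra.
have [x0|x0|->//] := ltgtP x 0.
  have : 0 < sin (- (x / 2)).
    by apply: sin_gt0_pi; move: xt => /andP[]; rewrite oppr_gt0; lra.
  by rewrite sinN s0 oppr0 ltxx.
have : 0 < sin (x / 2) by apply: sin_gt0_pi; move: xt => /andP[]; lra.
by rewrite s0 ltxx.
Qed.

Lemma unit_circle_param (x y : R) : x ^+ 2 + y ^+ 2 = 1 ->
  exists t, cos (tau * t) = x /\ sin (tau * t) = y.
Proof.
move=> xy; have x1 : -1 <= x <= 1 by apply/andP; split; nra.
have sa : sin (acos x) ^+ 2 = y ^+ 2.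
  by rewrite sin2cos2 acosK// -xy addrAC subrr add0r.
have pi0 : (2 * pi : R) != 0 by rewrite gt_eqF// mulr_gt0// pi_gt0.
move/eqP: sa; rewrite eqf_sqr => /orP[] /eqP sa.
  by exists (acos x / tau); rewrite mulrC divfK// acosK.
exists (- acos x / tau); rewrite mulrC divfK// cosN sinN acosK// sa opprK//.
Qed.

Definition circle x0 r t : R[i] := trig x0 r 0 t +i* trig 0 0 r t.

Definition circle_contour x0 r : contour R := @Contour R 1 (fun=> circle x0 r).

Lemma circle_derivative (x0 : R) r : path_derivative (circle x0 r)
  (fun t => trig 0 0 (- (tau * r)) t +i* trig 0 (tau * r) 0 t).
Proof.
move=> t; split.
  have := is_derive_trig x0 r 0 t; rewrite mulr0; apply.
have := is_derive_trig 0 0 r t; rewrite mulr0 oppr0; apply.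
Qed.

Lemma circle_smooth x0 r : 0 < r -> smooth_jordan_curve (circle x0 r).
Proof.
move=> r0; have t0 : 0 < tau by rewrite mulr_gt0// pi_gt0.
have tE : pi *+ 2 = tau by rewrite mulr_natl.
split.
- move=> t; rewrite /circle /trig mulrDr mulr1 -tE.
  by rewrite cosD2pi sinD2pi.
- move=> s t /andP[s0 s1] /andP[u0 u1] [].
  rewrite /trig !mul0r !addr0 !add0r => /addrI /(mulfI (lt0r_neq0 r0)) ec.
  move=> /(mulfI (lt0r_neq0 r0)) es.
  have : tau * (s - t) = 0.
    apply: cos_eq1; first by apply/andP; split; nra.
    by rewrite mulrBr cosB ec es -!expr2 cos2Dsin2.
  by move=> /eqP; rewrite mulf_eq0 (gt_eqF t0) /= subr_eq0 => /eqP.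
- by move=> n t; split; exact: derivable_derive1n_trig.
- move=> t; rewrite (velocityE (circle_derivative x0 r)).
  rewrite eq_complex /= /trig !mul0r !addr0 !add0r; apply/negP => /andP[/eqP a /eqP b].
  have n0 : tau * r != 0 by rewrite gt_eqF// mulr_gt0.
  have := cos2Dsin2 (tau * t); have -> : sin (tau * t) = 0.
    by move/eqP: a; rewrite mulf_eq0 oppr_eq0 (negPf n0) => /eqP.
  have -> : cos (tau * t) = 0 by move/eqP: b; rewrite mulf_eq0 (negPf n0) => /eqP.
  by rewrite expr0n /= addr0 => /eqP; rewrite eq_sym oner_eq0.
Qed.

Definition unit_circle t : R[i] := cos (tau * t) +i* sin (tau * t).

Lemma circleE x0 r t : circle x0 r t = x0%:C + r%:C * unit_circle t.
Proof. by apply: complex_eqP; rewrite !ReImE /= /trig; ring. Qed.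

Lemma norm_unit_circle t : `|unit_circle t| = 1.
Proof. by rewrite normc_def /= cos2Dsin2 sqrtr1. Qed.

Lemma unit_circle_neq0 t : unit_circle t != 0.
Proof. by rewrite -normr_eq0 norm_unit_circle oner_eq0. Qed.

Lemma unit_circle_derivative :
  path_derivative unit_circle (fun t => two_pi_i * unit_circle t).
Proof.
have e : unit_circle = circle 0 1.
  by apply/funext => t; rewrite circleE add0r mul1r.
rewrite {1}e; apply: eq_path_derivative (circle_derivative 0 1) => t.
by apply: complex_eqP; rewrite /two_pi_i !ReImE /= /trig; ring.
Qed.

Lemma circle_velocity x0 r t :
  velocity (circle x0 r) t = two_pi_i * r%:C * unit_circle t.
Proof.
rewrite (velocityE (circle_derivative x0 r)).
by apply: complex_eqP; rewrite /two_pi_i !ReImE /= /trig; ring.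
Qed.

Lemma norm_lt1_right z : `|z| < 1 -> 0 < complex.Re (1 - z : R[i]).
Proof.
move=> z1; have := le_lt_trans (normc_ge_Re z) z1.
have -> : 1 = (1 : R)%:C by [].
rewrite ltcR ReD ReN /= subr_gt0; exact: le_lt_trans (ler_norm _).
Qed.

(** Splits the integrand into a constant, with primitive [t w], and the derivative of a closed path;
    the constant is what the winding number sees. *)
Let primitive0 (phi psi : R -> R[i]) (w : R[i]) : path_derivative phi psi ->
  path_continuous psi -> phi 1 = phi 0 ->
  path_integral (fun t => w + psi t) = w.
Proof.
move=> dp cp e.
have dw : path_derivative (fun t => t%:C * w) (fun=> w).
  have dt : path_derivative (fun t : R => t%:C) (fun=> 1).
    by move=> t; split; [exact: is_derive_id|exact: is_derive_cst].
  by apply: eq_path_derivative (path_derivativeM dt (path_derivative_cst w)) => t;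
    rewrite mul1r mulr0 addr0.
rewrite path_integralD//; last exact: path_continuous_cst.
rewrite (path_integral_derivative dp)// e subrr addr0.
rewrite (path_integral_derivative dw); last exact: path_continuous_cst.
by rewrite mul1r mul0r subr0.
Qed.

(* On the circle [z - a = r (e - u)] with [e = exp (tau i t)] and [u = (a - x0) / r],
   so that [z' / (z - a) = tau i e / (e - u)] is [tau i + (log (1 - u / e))'] if
   [|u| < 1], and [(log (1 - e / u))'] if [|u| > 1]. *)
Lemma circle_winding x0 r a : 0 < r ->
  (`|a - x0%:C| < r%:C -> winding_number (circle_contour x0 r) a = 1) /\
  (r%:C < `|a - x0%:C| -> winding_number (circle_contour x0 r) a = 0).
Proof.
move=> r0; have rn : (r%:C : R[i]) != 0 by rewrite fmorph_eq0 gt_eqF.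
have rc0 : 0 < (r%:C : R[i]) by rewrite ltcR.
pose u := (a - x0%:C) / r%:C.
have nu : `|u| = `|a - x0%:C| / r%:C by rewrite normrM normfV (gtr0_norm rc0).
have e10 : unit_circle 1 = unit_circle 0.
  rewrite /unit_circle mulr1 mulr0; have -> : tau = 0 + pi *+ 2 by rewrite add0r mulr_natl.
  by rewrite cosD2pi sinD2pi.
have wE : winding_number (circle_contour x0 r) a = two_pi_i^-1 *
    path_integral (fun t => two_pi_i * unit_circle t / (unit_circle t - u)).
  congr (_ * _); rewrite /contour_integral big_ord1.
  rewrite -[LHS]/(path_integral _); apply: eq_path_integral => t /=.
  rewrite circle_velocity circleE.
  have -> : x0%:C + r%:C * unit_circle t - a = r%:C * (unit_circle t - u).
    by rewrite /u mulrBr mulrCA mulfV// mulr1; ring.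
  by rewrite invfM; move: rn (_ - u)^-1; move: (r%:C) => q q0 b; field.
have de := unit_circle_derivative.
split=> H; rewrite wE.
- have u1 : `|u| < 1 by rewrite nu ltr_pdivrMr// mul1r.
  have pos t : 0 < complex.Re (1 - u / unit_circle t).
    by apply: norm_lt1_right; rewrite normrM normfV norm_unit_circle invr1 mulr1.
  have n1 t : 1 - u / unit_circle t != 0.
    by apply: contraTneq (pos t) => ->; rewrite ltxx.
  have dv := path_derivativeD (path_derivative_cst 1) (path_derivativeN
    (path_derivativeM (path_derivative_cst u) (path_derivativeV de unit_circle_neq0))).
  have dl := path_derivative_right_log dv pos.
  have eL t : two_pi_i * unit_circle t / (unit_circle t - u) = two_pi_i +
     (0 - (0 / unit_circle t + u * (- (two_pi_i * unit_circle t) / unit_circle t ^+ 2))) /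
     (1 - u / unit_circle t).
    have e0 := unit_circle_neq0 t; have := n1 t.
    have -> : 1 - u / unit_circle t = (unit_circle t - u) / unit_circle t.
      by rewrite mulrBl mulfV.
    rewrite mulf_eq0 negb_or => /andP[eu _].
    by move: e0 eu; move: (unit_circle t) => e e0 eu; field; rewrite e0 eu.
  rewrite (eq_path_integral eL) (primitive0 two_pi_i dl); last 2 first.
  + have ce := path_derivative_continuous de.
    apply: path_continuousM; last first.
      exact: path_continuousV (path_derivative_continuous dv) n1.
    apply: path_continuousD; first exact: path_continuous_cst.
    apply: path_continuousN; apply: path_continuousD.
      apply: path_continuousM; first exact: path_continuous_cst.
      exact: path_continuousV ce unit_circle_neq0.
    apply: path_continuousM; first exact: path_continuous_cst.
    apply: path_continuousM.
      by apply: path_continuousN; apply: path_continuousM => //; exact: path_continuous_cst.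
    apply: path_continuousV; first exact: path_continuousX.
    by move=> t; rewrite expf_neq0// unit_circle_neq0.
  + by rewrite e10.
  by rewrite mulVf// two_pi_i_neq0.
- have u1 : 1 < `|u| by rewrite nu ltr_pdivlMr// mul1r.
  have u0 : u != 0 by apply: contraTneq u1 => ->; rewrite normr0 ltr10.
  have pos t : 0 < complex.Re (1 - unit_circle t * u^-1).
    apply: norm_lt1_right; rewrite normrM normfV norm_unit_circle mul1r.
    by rewrite invf_lt1// (lt_trans ltr01).
  have n1 t : 1 - unit_circle t * u^-1 != 0.
    by apply: contraTneq (pos t) => ->; rewrite ltxx.
  have dv := path_derivativeD (path_derivative_cst 1) (path_derivativeN
    (path_derivativeM de (path_derivative_cst u^-1))).
  have dl := path_derivative_right_log dv pos.
  have eL t : two_pi_i * unit_circle t / (unit_circle t - u) = 0 +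
     (0 - (two_pi_i * unit_circle t * u^-1 + unit_circle t * 0)) /
     (1 - unit_circle t * u^-1).
    have := n1 t; have -> : 1 - unit_circle t * u^-1 = (u - unit_circle t) / u.
      by rewrite mulrBl mulfV.
    rewrite mulf_eq0 negb_or => /andP[eu _].
    have eu' : unit_circle t - u != 0 by rewrite -opprB oppr_eq0.
    by move: eu eu' u0; move: (unit_circle t) (u) => e v eu eu' v0; field; rewrite eu eu' v0.
  rewrite (eq_path_integral eL) (primitive0 0 dl) ?mulr0//; last first.
    by rewrite e10.
  have ce := path_derivative_continuous de.
  apply: path_continuousM; last first.
    exact: path_continuousV (path_derivative_continuous dv) n1.
  apply: path_continuousD; first exact: path_continuous_cst.
  apply: path_continuousN; apply: path_continuousD.
    apply: path_continuousM; last exact: path_continuous_cst.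
    by apply: path_continuousM => //; exact: path_continuous_cst.
  by apply: path_continuousM => //; exact: path_continuous_cst.
Qed.

End Circle.

(** * Discs and their boundary circles *)

Section CircleBoundary.
Context {R : realType}.
Implicit Types (r : R) (z a : R[i]).

Lemma norm_complexE z : `|z| = (complex.Re `|z|)%:C.
Proof. by rewrite normc_def. Qed.

Lemma norm_real_complex (x : R) : `|x%:C : R[i]| = `|x|%:C.
Proof. by rewrite normc_def /= expr0n /= addr0 sqrtr_sqr. Qed.

Lemma pos_complexE z : 0 < z -> z = (complex.Re z)%:C /\ 0 < complex.Re z.
Proof. by case: z => a b; rewrite ltcE /= => /andP[/eqP -> ->]. Qed.

Definition disc (x0 : R) r : set R[i]^o := [set z : R[i] | `|z - x0%:C| < r%:C].

Lemma disc_open x0 r : open (disc x0 r).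
Proof.
have -> : disc x0 r = ball (x0%:C : R[i]^o) r%:C.
  by apply/seteqP; split => z; rewrite -ball_normE /= distrC.
exact: ball_open.
Qed.

Lemma norm_disc x0 r z : disc x0 r z -> `|z| <= (`|x0| + r)%:C.
Proof.
move=> zr; rewrite -[z](subrK x0%:C) (le_trans (ler_normD _ _))//.
by rewrite norm_real_complex rmorphD /= addrC lerD2l ltW.
Qed.

Lemma disc_closure x0 r z : 0 < r ->
  closure (disc x0 r) z <-> `|z - x0%:C| <= r%:C.
Proof.
move=> r0; split=> H.
  rewrite norm_complexE lecR leNgt; apply/negP => zr.
  pose n := complex.Re `|z - x0%:C|.
  have e0 : 0 < (n - r)%:C :> R[i] by rewrite ltcR subr_gt0.
  have [y [/= y1]] := H _ (nbhsx_ballx (z : R[i]^o) _ e0).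
  rewrite -ball_normE /= => y2; have : `|z - x0%:C| < n%:C.
    have -> : z - x0%:C = (z - y) + (y - x0%:C) by rewrite addrA subrK.
    rewrite (le_lt_trans (ler_normD _ _))//.
    have <- : (n - r)%:C + r%:C = n%:C by rewrite -rmorphD subrK.
    exact: ltrD.
  by rewrite norm_complexE ltcR ltxx.
move=> B /nbhs_ballP [e /= e0 eB]; have [eE e1] := pos_complexE e0.
(* [z] is pulled towards the centre by the factor [1 - s < 1]; the displacement is at most
   [s r = e r / (e + r) < e]. *)
pose s := complex.Re e / (complex.Re e + r).
have er : 0 < complex.Re e + r by rewrite addr_gt0.
have s0 : 0 < s by rewrite divr_gt0.
have s1 : s < 1 by rewrite ltr_pdivrMr// mul1r ltrDl.
exists (z - s%:C * (z - x0%:C)); split.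
  rewrite /disc /=; have -> : z - s%:C * (z - x0%:C) - x0%:C = (1 - s)%:C * (z - x0%:C).
    by rewrite rmorphB /= mulrBl mul1r; ring.
  rewrite normrM norm_real_complex [`|1 - s|]gtr0_norm ?subr_gt0//.
  have s2 : 0 <= (1 - s)%:C :> R[i] by rewrite ler0c subr_ge0 ltW.
  rewrite (le_lt_trans (ler_wpM2l s2 H))// -rmorphM /= ltcR.
  by rewrite gtr_pMl// ltrBlDr ltrDl.
apply: eB; rewrite -ball_normE /= opprB addrC subrK normrM norm_real_complex [`|s|]gtr0_norm//.
have s2 : 0 <= s%:C :> R[i] by rewrite ler0c ltW.
rewrite (le_lt_trans (ler_wpM2l s2 H))// -rmorphM /= eE ltcR.
by rewrite /s mulrAC ltr_pdivrMr// ltr_pM2l// ltrDr.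
Qed.

Lemma circle_trace x0 r : 0 < r ->
  contour_trace (circle_contour x0 r) = [set z : R[i] | `|z - x0%:C| = r%:C].
Proof.
move=> r0; apply/seteqP; split => z /=.
  move=> [k [t ->]] /=; rewrite circleE addrC addKr normrM norm_unit_circle mulr1.
  by rewrite norm_real_complex gtr0_norm.
move=> H; pose w := (z - x0%:C) / r%:C.
have rn : (r%:C : R[i]) != 0 by rewrite fmorph_eq0 gt_eqF.
have w1 : `|w| = 1.
  by rewrite normrM normfV H norm_real_complex gtr0_norm// mulfV.
have : complex.Re w ^+ 2 + complex.Im w ^+ 2 = 1.
  have := add_Re2_Im2 w; rewrite w1 expr1n => e; exact: (complexI e).
move=> /unit_circle_param [t [ct st]]; exists ord0, t => /=.
rewrite circleE; have -> : unit_circle t = w by apply: complex_eqP.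
by rewrite /w mulrC divfK// addrC subrK.
Qed.

Lemma circle_boundary x0 r : 0 < r ->
  smooth_oriented_boundary (circle_contour x0 r) (disc x0 r).
Proof.
move=> r0; split.
- by move=> k; exact: circle_smooth.
- by move=> j k s t _; rewrite (ord1 j) (ord1 k).
- rewrite circle_trace//; apply/seteqP; split => z /=.
    move=> zr; split; first by apply/disc_closure => //; rewrite zr.
    by rewrite /disc /= zr; apply/negP; rewrite ltxx.
  by move=> [/(disc_closure _ _ r0)]; rewrite le_eqVlt => /orP[/eqP //|] H H'.
- by move=> a ?; apply: (circle_winding x0 a r0).1.
- move=> a /(contra_not (disc_closure x0 a r0).2) /negP H.
  apply: (circle_winding x0 a r0).2; move: H.
  by rewrite norm_complexE lecR ltcR ltNge.
Qed.

(** The inverse of [1] plus the sum of the inverses replaces a minimum, and covers the empty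
    family. *)
Lemma finite_gap d (l : 'I_d -> R) : (forall i, 0 < l i) ->
  exists2 e : R, 0 < e <= 1 & forall i, e < l i.
Proof.
move=> l0; have S0 : 0 <= \sum_i (l i)^-1 by rewrite sumr_ge0// => i _; rewrite invr_ge0 ltW.
have p0 : 0 < 1 + \sum_i (l i)^-1 by rewrite ltr_wpDr.
exists (1 + \sum_i (l i)^-1)^-1 => [|i].
  by rewrite invr_gt0 p0 invf_le1// lerDl.
rewrite -[ltRHS]invrK ltf_pV2 ?posrE ?invr_gt0// (bigD1 i)//= addrCA ltrDl.
by rewrite ltr_wpDr// sumr_ge0// => j _; rewrite invr_ge0 ltW.
Qed.

Lemma spd_sqrt_contour d (A : 'M[R]_d) : spd A ->
  exists Omega G, sqrt_contour (spectrum A) Omega G.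
Proof.
move=> /spd_posdiag [Q [l [uQ l0 AE]]].
have [e /andP[e0 e1] el] := finite_gap l0.
have e2 : 0 < e / 2 by rewrite divr_gt0.
(* Points of the closed disc have real part at least [e / 2], so the slit is avoided. Each [l i]
   lies between [e] and [S], hence within [r - e / 2] of the centre, which leaves room for the
   tolerance [e / 2] of [eigenvalue_near]. The [2] keeps [r] positive for [d = 0]. *)
pose S := \sum_i l 0 i + 2; pose r := S - e / 2.
have lS i : l 0 i <= \sum_i l 0 i.
  by rewrite (bigD1 i)//= lerDl sumr_ge0// => j _; exact: ltW.
have L0 : 0 <= \sum_i l 0 i by rewrite sumr_ge0// => j _; exact: ltW.
have r0 : 0 < r by rewrite /r /S; lra.
exists (disc S r), (circle_contour S r); split.
- exact: disc_open.
- exists (`|S| + r)%:C; split; first by rewrite complex_real.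
  by move=> M MS z zS; apply: ltW; apply: le_lt_trans MS; exact: norm_disc.
- exact: circle_boundary.
- have [r' r'0 near_l] := eigenvalue_near l uQ e2.
  move=> z /= ez; have [|i zi] := near_l A _ z ez; first by rewrite -AE subrr normr0.
  rewrite /disc /=; have -> : z - S%:C = (z - (l 0 i)%:C) + (l 0 i - S)%:C.
    by rewrite rmorphB /= addrA subrK.
  rewrite (le_lt_trans (ler_normD _ _))// norm_real_complex.
  have lr : e / 2 + `|l 0 i - S| <= r.
    rewrite ler0_norm; last by have := lS i; rewrite /S; lra.
    by have := el i; rewrite /r; lra.
  have er : (e / 2)%:C + `|l 0 i - S|%:C <= r%:C by rewrite -rmorphD lecR.
  by rewrite (lt_le_trans _ er)// ltrD2r.
- move=> z /(disc_closure _ _ r0) H; apply/negP; rewrite lecE /= => /andP[_ z0].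
  have := le_trans (normc_ge_Re _) H; rewrite lecR !ReImE /=.
  rewrite ler0_norm; last by rewrite /S; lra.
  by rewrite /r; lra.
Qed.

End CircleBoundary.

(** * The holomorphic square root near a positive matrix *)

Section LocalSquareRoot.
Context {R : realType} {d : nat}.
Implicit Types (A S T M : 'M[R]_d) (G : contour R).

Lemma posdiag_Re_eigenvalue_gt0 S : posdiag S -> exists2 r : R, 0 < r &
  forall T, `|T - S| < r -> forall z, eigenvalue (complex_mx T) z -> 0 < complex.Re z.
Proof.
move=> [Q [s [uQ s0 SE]]]; have [e /andP[e0 _] es] := finite_gap s0.
have [r r0 rP] := eigenvalue_near s uQ e0; exists r => // T TS z ez.
have [|i zi] := rP T _ z ez; first by rewrite -SE.
have := le_lt_trans (normc_ge_Re _) zi; rewrite ltcR !ReImE /= => h.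
have := es i; have := ler_norm (- (complex.Re z - s 0 i)); rewrite normrN.
by lra.
Qed.

Lemma open_gap (Omega : set R[i]^o) z : open Omega -> Omega z ->
  exists2 e : R, 0 < e & forall w : R[i], `|w - z| < e%:C -> Omega w.
Proof.
move=> oO Oz; have /nbhs_ballP [e /= e0 eO] : nbhs (z : R[i]^o) Omega.
  exact: open_nbhs_nbhs.
have [eE e1] := pos_complexE e0; exists (complex.Re e) => // w wz.
by apply: eO; rewrite -ball_normE /= distrC eE.
Qed.

(** The contour stays fixed while the matrix moves: the open [Omega] contains discs around the
    eigenvalues of [S *m S], and by Bauer-Fike these catch all eigenvalues of a nearby [M]. No
    closeness is asked of [T], only eigenvalues with positive real part. *)
Lemma holomorphic_sqrt_near S Omega G : posdiag S ->
  sqrt_contour (spectrum (S *m S)) Omega G ->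
  exists2 r : R, 0 < r & forall M T, `|M - S *m S| < r -> T *m T = M ->
    (forall z, eigenvalue (complex_mx T) z -> 0 < complex.Re z) ->
    holomorphic_sqrt G (complex_mx M) = complex_mx T.
Proof.
move=> [Q [s [uQ s0 SE]]] [oO _ [jG _ trG w1 _] KO slit].
pose l : 'rV[R]_d := \row_i (s 0 i * s 0 i).
have SSE : S *m S = invmx Q *m diag_mx l *m Q.
  by rewrite SE !mulmxA mulmxK// -(mulmxA _ (diag_mx s) (diag_mx s)) mulmx_diag.
have el i : eigenvalue (complex_mx (S *m S)) (l 0 i)%:C.
  apply/eigenvalueP; exists (map_mx (real_complex R) (row i Q)).
    rewrite /complex_mx -map_mxM -map_mxZ; congr (map_mx _ _).
    rewrite -row_mul SSE !mulmxA mulmxV// mul1mx.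
    by apply/rowP => j; rewrite mul_diag_mx !mxE.
  apply/negP => /eqP/rowP H; have r0 : row i Q = 0.
    by apply/rowP => j; have := H j; rewrite !mxE => /complexI.
  have := mulmxV uQ => /(congr1 (row i)); rewrite row_mul r0 mul0mx.
  by move=> /rowP/(_ i)/eqP; rewrite !mxE eqxx eq_sym oner_eq0.
have /choice [e eP] : forall i, exists e : R, 0 < e /\
    forall w : R[i], `|w - (l 0 i)%:C| < e%:C -> Omega w.
  by move=> i; have [e e0 eP] := open_gap oO (KO _ (el i)); exists e.
have [e1 /andP[e10 _] e1e] := finite_gap (fun i => (eP i).1).
have [r r0 rP] := eigenvalue_near l uQ e10; exists r => // M T MS TM eT.
have regG := smooth_jordan_regular jG.
have trO k t : closure Omega (@curve R G k t) /\ ~ Omega (@curve R G k t).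
  have : contour_trace G (@curve R G k t) by exists k, t.
  by rewrite trG => -[].
refine (holomorphic_sqrt_eq regG _ _ _ eT).
- by move=> k t; have [/slit] := trO k t.
- by rewrite /complex_mx -map_mxM TM.
- move=> z ez; have Oz : Omega z.
    have [|i zi] := rP M _ z ez; first by rewrite -SSE.
    by apply: (eP i).2; rewrite (lt_trans zi)// ltcR.
  split; last exact: w1.
  by move=> k t; apply/negP => /eqP e2; have [_] := trO k t; rewrite e2.
Qed.

Lemma spd_Re_eigenvalue_gt0 A z :
  spd A -> eigenvalue (complex_mx A) z -> 0 < complex.Re z.
Proof.
move=> /spd_posdiag pA; have [r r0 rP] := posdiag_Re_eigenvalue_gt0 pA.
by apply: rP; rewrite subrr normr0.
Qed.

Context {V : normedModType R}.
Variable p : V.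
Implicit Types f g : V -> 'M[R]_d.

Definition tends f S := forall e : R, 0 < e -> \forall q \near p, `|f q - S| < e.

Lemma tendsM f g S T : tends f S -> tends g T ->
  tends (fun q => f q *m g q) (S *m T).
Proof.
move=> fS gT e e0; pose K := d%:R * (`|T| + 1 + `|S|).
have K0 : 0 <= K by rewrite mulr_ge0// !addr_ge0.
pose a := Num.min 1 (e / (K + 1)).
have a0 : 0 < a by rewrite lt_min ltr01 divr_gt0// ltr_wpDl.
apply: filterS2 (fS _ a0) (gT _ a0) => q h1 h2.
have -> : f q *m g q - S *m T = (f q - S) *m g q + S *m (g q - T).
  by rewrite mulmxBl mulmxBr addrA subrK.
have g1 : `|g q| <= `|T| + 1.
  rewrite -[g q](subrK T) (le_trans (ler_normD _ _))// addrC lerD2l.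
  by rewrite ltW// (lt_le_trans h2)// ge_min lexx.
have b1 : `|(f q - S) *m g q| <= d%:R * a * (`|T| + 1).
  rewrite (le_trans (norm_mulmx _ _))//.
  by apply: ler_pM; rewrite ?mulr_ge0// ler_wpM2l// ltW.
have b2 : `|S *m (g q - T)| <= d%:R * a * `|S|.
  rewrite (le_trans (norm_mulmx _ _))// mulrAC.
  by rewrite ler_wpM2r// ler_wpM2l// ltW.
apply: (le_lt_trans (le_trans (ler_normD _ _) (lerD b1 b2))).
have -> : d%:R * a * (`|T| + 1) + d%:R * a * `|S| = a * K by rewrite /K; ring.
apply: (@le_lt_trans _ _ (e / (K + 1) * K)).
  by rewrite ler_wpM2r// ge_min lexx orbT.
by rewrite mulrAC ltr_pdivrMr ?ltr_wpDl// ltr_pM2l// ltrDl.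
Qed.

Lemma tends_invmx f S : S \in unitmx -> tends f S ->
  tends (fun q => invmx (f q)) (invmx S) /\ \forall q \near p, f q \in unitmx.
Proof.
move=> uS fS; have [e1 [c [e10 c0 H]]] := invmx_bound_near uS; split; last first.
  by apply: filterS (fS _ e10) => q /ltW /H [].
move=> e e0; pose K := d%:R * d%:R * c * `|invmx S|.
have K0 : 0 <= K by rewrite !mulr_ge0// ltW.
pose a := Num.min e1 (e / (K + 1)).
have a0 : 0 < a by rewrite lt_min e10 divr_gt0// ltr_wpDl.
apply: filterS (fS _ a0) => q h1.
have [|uf fc] := H (f q); first by rewrite ltW// (lt_le_trans h1)// ge_min lexx.
have -> : invmx (f q) - invmx S = - (invmx (f q) *m (f q - S) *m invmx S).
  by rewrite mulmxBr mulVmx// mulmxBl mul1mx mulmxK// opprB.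
rewrite normrN; have b : `|invmx (f q) *m (f q - S) *m invmx S| <= a * K.
  rewrite (le_trans (norm_mulmx _ _))//.
  have -> : a * K = d%:R * (d%:R * c * a) * `|invmx S| by rewrite /K; ring.
  rewrite ler_wpM2r// ler_wpM2l// (le_trans (norm_mulmx _ _))//.
  by apply: ler_pM; rewrite ?mulr_ge0 ?ler_wpM2l// ltW.
apply: (le_lt_trans b); apply: (@le_lt_trans _ _ (e / (K + 1) * K)).
  by rewrite ler_wpM2r// ge_min lexx orbT.
by rewrite mulrAC ltr_pdivrMr ?ltr_wpDl// ltr_pM2l// ltrDl.
Qed.

(** The root supplied by the fixed point theorem depends on the tolerance. Identifying it with the
    real part of the holomorphic square root gives one function [g] for all tolerances. *)
Lemma tends_sqrt f S Omega G : posdiag S ->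
  sqrt_contour (spectrum (S *m S)) Omega G -> tends f (S *m S) ->
  exists g, [/\ tends g S, \forall q \near p, g q *m g q = f q &
    \forall q \near p, holomorphic_sqrt G (complex_mx (f q)) = complex_mx (g q)].
Proof.
move=> pS cG fS; have [r1 r10 H1] := holomorphic_sqrt_near pS cG.
have [r2 r20 H2] := posdiag_Re_eigenvalue_gt0 pS.
pose g q := map_mx (@complex.Re R) (holomorphic_sqrt G (complex_mx (f q))).
have gE M : map_mx (@complex.Re R) (complex_mx M) = M.
  by apply/matrixP => i j; rewrite !mxE.
have key (e : R) : 0 < e -> \forall q \near p, [/\ `|g q - S| < e,
    g q *m g q = f q & holomorphic_sqrt G (complex_mx (f q)) = complex_mx (g q)].
  move=> e0; have m0 : 0 < Num.min e r2 by rewrite lt_min e0.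
  have [r3 r30 H3] := sqrt_near_exists pS m0.
  have m1 : 0 < Num.min r1 r3 by rewrite lt_min r10.
  apply: filterS (fS _ m1) => q; rewrite lt_min => /andP[q1 q3].
  have [T] := H3 _ q3; rewrite lt_min => /andP[Te Tr] TT.
  have hT := H1 _ _ q1 TT (H2 _ Tr).
  have gT : g q = T by rewrite /g hT gE.
  by rewrite gT.
exists g; split.
- by move=> e e0; apply: filterS (key e e0) => q [].
- by apply: filterS (key 1 ltr01) => q [].
- by apply: filterS (key 1 ltr01) => q [].
Qed.

End LocalSquareRoot.

(** * The extension of [Phi] near a pair of positive definite matrices *)

Section Continuity.
Context {R : realType} {d : nat}.
Local Notation V := (gaussian_pair R d).

Lemma tends_cov (p : V) :
  tends p (fun q : V => q.2.1) p.2.1 /\ tends p (fun q : V => q.2.2) p.2.2.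
Proof.
have H (e : R) : 0 < e -> \forall q \near p, `|q - p| < e.
  move=> e0; apply: (@near_mono _ _ (fun q => ball p e q)); last exact: nbhsx_ballx.
  by move=> q; rewrite -ball_normE /= distrC.
split=> e /H; apply: near_mono => q; apply: le_lt_trans.
  exact: (norm21 (q - p)).
exact: (norm22 (q - p)).
Qed.

Lemma Phi_extE (G1 G2 : contour R) (q : V) (S T : 'M[R]_d) :
  holomorphic_sqrt G1 (complex_mx q.2.1) = complex_mx S ->
  holomorphic_sqrt G2 (complex_mx (S *m q.2.2 *m S)) = complex_mx T ->
  Phi_ext G1 G2 q =
  (sqr_dist q.1.1 q.1.2 + \tr q.2.1 + \tr q.2.2 - 2 * \tr T)%:C.
Proof.
case: q => [[mu nu] [A B]] /= -> ; rewrite /complex_mx !map_mxM => ->.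
by rewrite trace_map_mx rmorphB rmorphM /= rmorph_nat.
Qed.

End Continuity.

Unset Implicit Arguments.

Theorem theorem2p6 (R : realType) (d : nat)
    (mu nu : 'rV[R]_d) (A B : 'M[R]_d) (spdA : spd A) (spdB : spd B) :
  let p : gaussian_pair R d := (mu, nu, (A, B)) in
  let K1 := spectrum A in
  let K2 := spectrum (spectral_sqrt A *m B *m spectral_sqrt A) in
  (exists Omega1 G1, sqrt_contour K1 Omega1 G1) /\
  (exists Omega2 G2, sqrt_contour K2 Omega2 G2) /\
  forall (Omega1 Omega2 : set R[i]) (G1 G2 : contour R),
    sqrt_contour K1 Omega1 G1 -> sqrt_contour K2 Omega2 G2 ->
    let F (q : gaussian_pair R d) : R := complex.Re (Phi_ext G1 G2 q) in
    [/\ (\forall q \near p, complex.Im (Phi_ext G1 G2 q) = 0),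
        (\forall q \near p, spd q.2.1 -> spd q.2.2 -> F q = Phi q),
        twice_differentiable F p,
        biscalar (D2 F p) /\ (forall v w : gaussian_pair R d, D2 F p v w = D2 F p w v) &
        forall b : gaussian_pair R d -> gaussian_pair R d -> R,
          biscalar b -> (forall v w, b v w = b w v) ->
          (forall (g g' : 'rV[R]_d) (H H' : 'M[R]_d),
             b (g, g', (H, H')) (g, g', (H, H')) =
             D2 F p (g, g', (H, H')) (g, g', (H, H'))) ->
          b = D2 F p].
Proof.
move=> p K1 K2; set S1 := spectral_sqrt A in K2 *.
have [spdS1 S1sq] := spd_sqrt spdA.
have uS1 := posdiag_unit (spd_posdiag spdS1).
have spdM : spd (S1 *m B *m S1) by rewrite -[X in _ *m X]spdS1.1; exact: spd_congruence.
set S2 := spectral_sqrt (S1 *m B *m S1).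
have [spdS2 S2sq] := spd_sqrt spdM.
split; first exact: spd_sqrt_contour.
split; first exact: spd_sqrt_contour.
move=> Omega1 Omega2 G1 G2 cG1 cG2 F.
have cG1' : sqrt_contour (spectrum (S1 *m S1)) Omega1 G1 by rewrite S1sq.
have cG2' : sqrt_contour (spectrum (S2 *m S2)) Omega2 G2 by rewrite S2sq.
have [tA tB] := tends_cov p.
have tA' : tends p (fun q : gaussian_pair R d => q.2.1) (S1 *m S1) by rewrite S1sq.
have [T1 [tT1 T1sq T1E]] := tends_sqrt (spd_posdiag spdS1) cG1' tA'.
pose M (q : gaussian_pair R d) := T1 q *m q.2.2 *m T1 q.
have tM : tends p M (S2 *m S2).
  by rewrite S2sq; apply: tendsM => //; apply: tendsM.
have [T2 [tT2 T2sq T2E]] := tends_sqrt (spd_posdiag spdS2) cG2' tM.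
have [tI1 uT1] := tends_invmx uS1 tT1.
(* With [T1 T1 = A] and [T2 T2 = T1 B T1], the square of [U] is [T1 (T1 B T1) T1^-1 = A B], and its
   trace is that of [T2]. *)
pose U q := T1 q *m T2 q *m invmx (T1 q).
pose U0 := S1 *m S2 *m invmx S1.
have tU : tends p U U0 by apply: tendsM => //; apply: tendsM.
have pU0 : posdiag U0 by apply: posdiag_conj => //; exact: spd_posdiag.
have U0sq : U0 *m U0 = cov_prod p.
  rewrite /U0 !mulmxA mulmxKV// -(mulmxA S1) S2sq !mulmxA S1sq.
  by rewrite -mulmxA mulmxV// mulmx1.
have PhiE : \forall q \near p, Phi_ext G1 G2 q =
    (sqr_dist q.1.1 q.1.2 + \tr q.2.1 + \tr q.2.2 - 2 * \tr (U q))%:C.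
  apply: near_mono (near_and T1E (near_and T2E uT1)) => q [e1 [e2 u1]].
  by rewrite (Phi_extE e1 e2) /U mxtrace_mulC mulKmx.
have Unear (e : R) : 0 < e -> \forall q \near p,
    [/\ `|U q - U0| <= e, U q *m U q = cov_prod q &
      F q = sqr_dist q.1.1 q.1.2 + \tr q.2.1 + \tr q.2.2 - 2 * \tr (U q)].
  move=> e0; apply: near_mono (near_and (tU e e0) (near_and PhiE
    (near_and T1sq (near_and T2sq uT1)))) => q [h1 [h2 [h3 [h4 h5]]]].
  split; [exact: ltW| |by rewrite /F h2].
  rewrite /U !mulmxA mulmxKV// -(mulmxA (T1 q)) h4 /M !mulmxA h3.
  by rewrite -mulmxA mulmxV// mulmx1.
have [e [c [c0 goodp sylv invU]]] := near_posdiag_sqrt pU0 Unear.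
have [L sL] := sylvester_inverse_exists pU0.
have [dF hF] := hessian_second_derivative pU0 U0sq c0 goodp sylv invU sL.
have D2F : D2 F p = hessian L (invmx U0) p := D2E hF.
have sym v w : D2 F p v w = D2 F p w v.
  by rewrite D2F; apply: hessian_sym sL; exact: posdiag_unit.
have bi : biscalar (D2 F p) by rewrite D2F; have [] := hF.
split=> //.
- by apply: near_mono PhiE => q ->.
(* On positive definite pairs near [p] the spectral roots have positive eigenvalues, which is what
   [holomorphic_sqrt_near] asks of a root; so continuity of [spectral_sqrt] does not enter. *)
- have [r1 r10 H1] := holomorphic_sqrt_near (spd_posdiag spdS1) cG1'.
  have [r2 r20 H2] := holomorphic_sqrt_near (spd_posdiag spdS2) cG2'.
  apply: near_mono (near_and (tA' _ r10) (near_and (tM _ r20) T1E)).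
  move=> q [h1 [h2 h3]] spdA' spdB'.
  have [spdT1 T1sq'] := spd_sqrt spdA'.
  have e1 := H1 _ _ h1 T1sq' (fun z => spd_Re_eigenvalue_gt0 spdT1).
  have T1q : T1 q = spectral_sqrt q.2.1.
    by move: h3; rewrite e1 => /map_mx_inj ->.
  have uT : spectral_sqrt q.2.1 \in unitmx by exact/posdiag_unit/spd_posdiag.
  have spdM' : spd (M q).
    by rewrite /M T1q -[X in _ *m X]spdT1.1; exact: spd_congruence.
  have [spdT2 T2sq'] := spd_sqrt spdM'.
  have e2 := H2 _ _ h2 T2sq' (fun z => spd_Re_eigenvalue_gt0 spdT2).
  rewrite /F; rewrite /M T1q in e2; rewrite (Phi_extE e1 e2) /=.
  by case: q {h1 h2 h3 spdA' spdB' spdT1 T1sq' e1 T1q uT spdM' spdT2 T2sq' e2} => [[m n] [A' B']].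
- by split=> //; exists (hessian L (invmx U0) p).
- move=> b bb bs bq; apply: polarization => // -[[g g'] [H H']]; exact: bq.
Qed.
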